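(* Let $X$ be a complex vector space with $\dim_{\mathbb{C}}X\ge2$ and $Y\ne\{0\}$ a sequentially complete Hausdorff complex locally convex space. Let $\Omega\subset X$ be a polygonally connected $2$-open set, $f\in\mathcal{H}_G(\Omega,Y)$, and $p$ a continuous seminorm on $Y$ with $p\not\equiv0$. If $c\in\Omega$ is a $\tau_{(1)}$-local maximum of $p\circ f$, then $c$ is a global minimum of $p\circ f$ on $\Omega$ and the closure of $f(\Omega)$ has empty interior in $Y$. In particular, if $p(f(c))>0$ then $0\notin f(\Omega)$.
   Context: $\Gamma_{1,d}(X)$: complex affine subspaces of $X$ of dimension $1,\dots,d$, with Euclidean topology. $A\subset X$ is $d$-open if $A\cap L$ is open in $L$ for all $L\in\Gamma_{1,d}(X)$. $\tau_{(1)}$ is the topology on $X$ whose open sets are the $1$-open sets. Polygonally connected: any two points can be joined by a polygonal chain within the set. $\mathcal{H}_G(\Omega,Y)$: Gâteaux holomorphic maps, i.e. for all $a\in\Omega$, $v\in X$, $\varphi\in Y^*$, $\lambda\mapsto\varphi(f(a+\lambda v))$ is holomorphic on some disc around $0$. *)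

(* Defs.v *)
From HB Require Import structures.
From mathcomp Require Import all_boot all_order all_algebra.
From mathcomp Require Import all_classical all_reals all_analysis.
From mathcomp.real_closed Require Import complex.
Set Implicit Arguments. Unset Strict Implicit. Unset Printing Implicit Defensive.
Import Order.TTheory GRing.Theory Num.Theory.
Local Open Scope classical_set_scope.
Local Open Scope ring_scope.

Section Defs.
Variable R : realType.
Local Notation C := (R[i]).

Section OnX.
Variable X : lmodType C.

Definition lin_indep (k : nat) (v : 'I_k -> X) : Prop :=
  forall c : 'I_k -> C, \sum_(j < k) c j *: v j = 0 -> forall j, c j = 0.

Definition dim_ge2 : Prop :=
  exists u w : X, forall a b : C, a *: u + b *: w = 0 -> a = 0 /\ b = 0.

(* A is d-open: for every complex affine subspace L = a + span(v_1..v_k)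
   with 1 <= k <= d (v linearly independent), A ∩ L is open in L for the
   Euclidean topology, i.e. its preimage under the affine parametrisation
   C^k -> L is open in C^k. *)
Definition d_open (d : nat) (A : set X) : Prop :=
  forall (k : nat), (1 <= k <= d)%N ->
  forall (a : X) (v : 'I_k -> X), lin_indep v ->
    open [set z : 'rV[C^o]_k | A (a + \sum_(j < k) z ord0 j *: v j)].

Definition tau1_local_max (Om : set X) (g : X -> R) (c : X) : Prop :=
  exists U : set X, d_open 1 U /\ U c /\
    forall x, U x -> Om x -> g x <= g c.

Definition polygonally_connected (Om : set X) : Prop :=
  forall x y, Om x -> Om y ->
    exists (n : nat) (z : nat -> X), z 0%N = x /\ z n = y /\
      forall i, (i < n)%N -> forall t : R, 0 <= t <= 1 ->
        Om ((1 - (t%:C)%C) *: z i + (t%:C)%C *: z i.+1).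

Definition holo_on_disc (g : C -> C) (r : R) : Prop :=
  forall l : C, Normc.normc l < r -> derivable (g : C^o -> C^o) l 1.

Definition gateaux_holomorphic (Y : tvsType C) (Om : set X) (f : X -> Y) : Prop :=
  forall a : X, Om a -> forall v : X,
  forall phi : {linear Y -> C^o}, continuous phi ->
    exists2 r : R, 0 < r &
      (forall l : C, Normc.normc l < r -> Om (a + l *: v)) /\
      holo_on_disc (fun l : C => phi (f (a + l *: v))) r.
End OnX.

Section OnY.
Variable Y : tvsType C.   (* tvsType = locally convex topological vector space *)

Definition seq_cauchy (u : nat -> Y) : Prop :=
  forall U : set Y, nbhs 0 U ->
    exists N : nat, forall m n, (N <= m)%N -> (N <= n)%N -> U (u m - u n).

Definition sequentially_complete : Prop :=
  forall u : nat -> Y, seq_cauchy u -> exists l : Y, u @ \oo --> l.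

Definition continuous_seminorm (p : Y -> R) : Prop :=
  [/\ forall x, 0 <= p x,
      forall x y, p (x + y) <= p x + p y,
      forall (a : C) x, p (a *: x) = Normc.normc a * p x
    & continuous (p : Y -> R^o)].
End OnY.

End Defs.

(* Main.v *)
Require Import Defs.
From HB Require Import structures.
From mathcomp Require Import all_boot all_order all_algebra.
From mathcomp Require Import all_classical all_reals all_analysis.
From mathcomp.real_closed Require Import complex.
From mathcomp Require Import ring lra.
Set Implicit Arguments. Unset Strict Implicit. Unset Printing Implicit Defensive.
Import Order.TTheory GRing.Theory Num.Theory.
Import numFieldNormedType.Exports.
Local Open Scope classical_set_scope.
Local Open Scope ring_scope.

(* By Hahn-Banach there is a continuous functional [phi] with [|phi| <= p] and
   [phi (f c) = p (f c)]. On each complex line through [c] the holomorphic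
   function [phi o f] has a local maximum of its real part at [c], so it is
   constant near [c] on that line. Constancy on all lines through a point [a]
   spreads to every polydisc around [a] inside a plane section of [Om], because
   the polydisc is a union of discs centered at [a]; chains of polydiscs along
   segments, which exist since [Om] is 2-open, carry it to all of [Om]. Hence
   [p (f x) >= |phi (f x)| = p (f c)]. When [p (f c) = 0] any [phi] dominated
   by [p] qualifies, so [phi] can be taken nonzero and [f (Om)] lies in a closed
   hyperplane.
   The mean value property comes from Goursat's argument in polar coordinates,
   with partial antiderivatives in place of path integrals, and the identity
   theorem follows from the maximum principle applied to [h z / z ^+ n]. *)

Local Notation re := complex.Re.
Local Notation im := complex.Im.
Local Notation normc := Normc.normc.

(** * Sublinear functionals and the Hahn-Banach theorem *)

Section HahnBanach.
Variables (R : realType) (V : lmodType R[i]).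
Implicit Types (q : V -> R) (x y : V).

Definition sublinear q : Prop :=
  (forall x y, q (x + y) <= q x + q y) /\
  (forall (t : R) x, 0 <= t -> q ((t%:C)%C *: x) = t * q x).

Lemma sublinear0 q : sublinear q -> q 0 = 0.
Proof. by case=> _ /(_ 0 0 (lexx 0)); rewrite scaler0 mul0r. Qed.

Lemma sublinear_opp q x : sublinear q -> - q (- x) <= q x.
Proof.
move=> qs; have [sub _] := qs; rewrite lerNl -subr_ge0 opprK addrC.
by rewrite -(sublinear0 qs) -(subrr x) sub.
Qed.

(* The largest sublinear minorant [r] of [q] with [r (- y) <= - q y]. *)
Definition tilt q y x : R :=
  inf [set q (x + (t%:C)%C *: y) - t * q y | t in [set t : R | 0 <= t]].

Section tilt.
Variables (q : V -> R) (y : V).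
Hypothesis qs : sublinear q.
Let S x := [set q (x + (t%:C)%C *: y) - t * q y | t in [set t : R | 0 <= t]].

(** The infimum in [tilt] is a true one only if the set is bounded below; the bound is [t * q y = q
    (t y) <= q (x + t y) + q (- x)]. *)
Let lbS x : lbound (S x) (- q (- x)).
Proof.
have [sub hom] := qs.
move=> _ [t t0 <-]; rewrite lerBrDl -hom // lerBlDr.
by apply: le_trans (sub _ _); rewrite addrAC subrr add0r.
Qed.

Let SN0 x : S x !=set0.
Proof. by exists (q (x + (0%:C)%C *: y) - 0 * q y), 0 => /=. Qed.

Lemma tilt_le t x : 0 <= t -> tilt q y x <= q (x + (t%:C)%C *: y) - t * q y.
Proof. by move=> t0; apply: ge_inf; [exists (- q (- x)); exact: lbS | exists t]. Qed.

Lemma le_tilt m x : (forall t, 0 <= t -> m <= q (x + (t%:C)%C *: y) - t * q y) ->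
  m <= tilt q y x.
Proof. by move=> h; apply: lb_le_inf; [exact: SN0|]; move=> _ [t t0 <-]; exact: h. Qed.

Lemma tilt_le_id x : tilt q y x <= q x.
Proof.
by have := tilt_le x (lexx 0); rewrite scale0r addr0 mul0r subr0.
Qed.

Lemma tilt_opp : tilt q y (- y) <= - q y.
Proof.
have := tilt_le (- y) (@ler01 R).
by rewrite scale1r addNr sublinear0 // mul1r sub0r.
Qed.

Lemma tilt_sublinear : sublinear (tilt q y).
Proof.
have [sub hom] := qs; split.
  move=> x x'; rewrite -lerBlDr; apply: le_tilt => t t0.
  rewrite lerBlDr -lerBlDl; apply: le_tilt => t' t0'; rewrite lerBlDr.
  apply: le_trans (tilt_le _ (addr_ge0 t0 t0')) _.
  have := sub (x + (t%:C)%C *: y) (x' + (t'%:C)%C *: y).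
  rewrite addrACA -scalerDl -rmorphD; lra.
(* One inequality suffices: applied to [t^-1] and [t x] it gives the reverse one. *)
have half (t : R) x : 0 < t -> tilt q y ((t%:C)%C *: x) <= t * tilt q y x.
  move=> t0; rewrite mulrC -ler_pdivrMr //; apply: le_tilt => s s0.
  rewrite ler_pdivrMr //.
  apply: le_trans (tilt_le _ (mulr_ge0 (ltW t0) s0)) _.
  have -> : ((t * s)%:C)%C *: y = (t%:C)%C *: ((s%:C)%C *: y) by rewrite rmorphM scalerA.
  rewrite -scalerDr hom; last exact: ltW.
  lra.
move=> t x; rewrite le_eqVlt => /orP[/eqP <-|t0].
  rewrite scale0r mul0r; apply/eqP; rewrite eq_le; apply/andP; split.
    by rewrite -[leRHS](sublinear0 qs) tilt_le_id.
  apply: le_tilt => s s0; rewrite add0r hom // subrr //.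
apply/eqP; rewrite eq_le half //=.
have := half t^-1 ((t%:C)%C *: x); rewrite invr_gt0 => /(_ t0).
rewrite scalerA -rmorphM mulVf ?gt_eqF // scale1r.
by rewrite -(ler_pM2l t0) mulrA mulfV ?gt_eqF // mul1r.
Qed.

End tilt.

(** The pointwise infimum of a chain is sublinear: of the two members used at [x] and at [y], the
    smaller one serves at both points. *)
Lemma sublinear_inf (A : set (V -> R)) (q0 : V -> R) :
  A q0 -> (forall q, A q -> sublinear q) ->
  (forall q r, A q -> A r -> (forall x, q x <= r x) \/ (forall x, r x <= q x)) ->
  exists r, sublinear r /\ forall q, A q -> forall x, r x <= q x.
Proof.
move=> Aq0 As Atot.
have lbA x : lbound [set q x | q in A] (- q0 (- x)).
  move=> _ [q Aq <-].
  have [le|le] := Atot _ _ Aq Aq0.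
    by apply: le_trans (sublinear_opp x (As _ Aq)); rewrite lerN2.
  by apply: le_trans (le x); exact/sublinear_opp/As.
pose r x := inf [set q x | q in A].
have rle q x : A q -> r x <= q x.
  by move=> Aq; apply: ge_inf; [exists (- q0 (- x)); exact: lbA | exists q].
have ler m x : (forall q, A q -> m <= q x) -> m <= r x.
  by move=> h; apply: lb_le_inf; [exists (q0 x); exists q0 | move=> _ [q Aq <-]; exact: h].
exists r; split; last by move=> q Aq x; exact: rle.
split.
  move=> x y; rewrite -lerBlDr; apply/ler => q Aq; rewrite lerBlDr -lerBlDl.
  apply/ler => q' Aq'; rewrite lerBlDr.
  have [le|le] := Atot _ _ Aq Aq'.
    apply: le_trans (rle _ _ Aq) _; apply: le_trans (proj1 (As _ Aq) _ _) _.
    by rewrite addrC lerD2r.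
  apply: le_trans (rle _ _ Aq') _; apply: le_trans (proj1 (As _ Aq') _ _) _.
  by rewrite addrC lerD2l.
move=> t x; rewrite le_eqVlt => /orP[/eqP <-|t0].
  rewrite scale0r mul0r; apply/eqP; rewrite eq_le -{1}(sublinear0 (As _ Aq0)) rle //=.
  by apply/ler => q Aq; rewrite (sublinear0 (As _ Aq)).
apply/eqP; rewrite eq_le; apply/andP; split.
  rewrite mulrC -ler_pdivrMr //; apply/ler => q Aq; rewrite ler_pdivrMr // mulrC.
  by rewrite -(proj2 (As _ Aq)) ?(ltW t0) // rle.
apply/ler => q Aq; rewrite (proj2 (As _ Aq)) ?(ltW t0) // ler_pM2l //; exact: rle.
Qed.

(** Zorn's lemma for the reversed pointwise order; [sublinear_inf] bounds the nonempty chains and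
    [q] itself the empty one. *)
Lemma minimal_sublinear q : sublinear q ->
  exists l, [/\ sublinear l, (forall x, l x <= q x) &
    forall r, sublinear r -> (forall x, r x <= l x) -> forall x, r x = l x].
Proof.
move=> qs.
pose T := {l : V -> R | sublinear l /\ forall x, l x <= q x}.
pose Rel (a b : T) := `[< forall x, sval b x <= sval a x >].
have [| | | |t tmax] := @Zorn T Rel.
- by move=> t; apply/asboolP.
- move=> r s t /asboolP rs /asboolP st; apply/asboolP => x.
  exact: le_trans (st x) (rs x).
- move=> [s s1] [t t1] /asboolP /= st /asboolP /= ts.
  by apply: eq_exist; apply/funext => x; apply/eqP; rewrite eq_le st ts.
- move=> A Atot; have [[a Aa]|A0] := pselect (exists a, A a); last first.
    by exists (exist _ q (conj qs (fun x => lexx (q x)))) => s As; case: A0; exists s.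
  have [r [rs rle]] := @sublinear_inf [set sval s | s in A] (sval a)
    (ex_intro2 _ _ a Aa erefl) ltac:(by move=> _ [s _ <-]; case: (svalP s))
    ltac:(by move=> _ _ [s As <-] [t At <-];
      case: (Atot _ _ As At) => /asboolP ?; [right|left]).
  have rq x : r x <= q x.
    by apply: le_trans (rle (sval a) _ x) _; [exists a | case: (svalP a)].
  exists (exist _ r (conj rs rq)) => s As; apply/asboolP => x /=.
  by apply: rle; exists s.
exists (sval t); case: (svalP t) => ts tq; split => // r rs rt x.
have rq y : r y <= q y by exact: le_trans (rt y) (tq y).
by rewrite -(tmax (exist _ r (conj rs rq))) //; exact/asboolP.
Qed.

(* A minimal sublinear [l] equals each of its tilts, so it is odd. *)
Lemma hahn_banach_real q x0 : sublinear q ->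
  exists l : V -> R, [/\ (forall x y, l (x + y) = l x + l y),
    (forall (t : R) x, l ((t%:C)%C *: x) = t * l x), (forall x, l x <= q x) &
    l x0 = q x0].
Proof.
(* Minimising below the tilt at [x0] rather than below [q] gives [l (- x0) <= - q x0], hence
   equality at [x0]. *)
move=> qs; have [l [ls lq lmin]] := minimal_sublinear (tilt_sublinear x0 qs).
have lN y : l (- y) = - l y.
  apply/eqP; rewrite eq_le; apply/andP; split; last first.
    by rewrite lerNl; exact: sublinear_opp.
  rewrite -(lmin (tilt l y)); [exact: tilt_opp|exact: tilt_sublinear|].
  exact: tilt_le_id.
have [sub hom] := ls; exists l; split.
- move=> x y; apply/eqP; rewrite eq_le sub /=.
  have := sub (x + y) (- y); rewrite addrK lN; lra.
- move=> t x; have [t0|t0] := leP 0 t; first exact: hom.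
  by rewrite -[t in LHS]opprK rmorphN scaleNr lN hom ?oppr_ge0 ?(ltW t0) // mulNr opprK.
- by move=> x; apply: le_trans (lq x) (tilt_le_id x0 qs x).
- apply/eqP; rewrite eq_le (le_trans (lq x0) (tilt_le_id x0 qs x0)) /=.
  by rewrite -lerN2 -lN (le_trans (lq _)) // tilt_opp.
Qed.

End HahnBanach.

(** * Modulus, real part and imaginary part *)

Section ComplexModulus.
Variable R : realType.
Implicit Types z w : R[i].

Lemma normc_sqr z : normc z ^+ 2 = re z ^+ 2 + im z ^+ 2.
Proof. by case: z => a b /=; rewrite sqr_sqrtr // addr_ge0 // sqr_ge0. Qed.

Lemma normc_ge0 z : 0 <= normc z.
Proof. by case: z => a b /=; exact: sqrtr_ge0. Qed.

Lemma normc_real (t : R) : normc (t%:C)%C = `|t|.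
Proof. by rewrite /= expr0n addr0 sqrtr_sqr. Qed.

Lemma re_le_normc z : `|re z| <= normc z.
Proof.
rewrite -(@ler_pXn2r _ 2) ?nnegrE ?normc_ge0 // normc_sqr real_normK ?num_real //.
by rewrite lerDl sqr_ge0.
Qed.

Lemma im_le_normc z : `|im z| <= normc z.
Proof.
rewrite -(@ler_pXn2r _ 2) ?nnegrE ?normc_ge0 // normc_sqr real_normK ?num_real //.
by rewrite lerDr sqr_ge0.
Qed.

Lemma reD z w : re (z + w) = re z + re w. Proof. by case: z w => ? ? []. Qed.
Lemma imD z w : im (z + w) = im z + im w. Proof. by case: z w => ? ? []. Qed.
Lemma reN z : re (- z) = - re z. Proof. by case: z. Qed.
Lemma imN z : im (- z) = - im z. Proof. by case: z. Qed.
Lemma reM z w : re (z * w) = re z * re w - im z * im w.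
Proof. by case: z w => ? ? []. Qed.
Lemma imM z w : im (z * w) = re z * im w + im z * re w.
Proof. by case: z w => ? ? []. Qed.

Lemma complexP z w : re z = re w -> im z = im w -> z = w.
Proof. by case: z w => ? ? [? ?] /= -> ->. Qed.

(* Equality case of [re z <= normc z]. *)
Lemma normc_le_re z (m : R) : normc z <= m -> re z = m -> z = (m%:C)%C.
Proof.
move=> zm rez; apply: complexP; rewrite ?rez //=.
apply/eqP; rewrite -sqrf_eq0 eq_le sqr_ge0 andbT.
have m0 : 0 <= m by exact: le_trans (normc_ge0 z) zm.
have : normc z ^+ 2 <= m ^+ 2 by rewrite ler_pXn2r ?nnegrE ?normc_ge0.
by rewrite normc_sqr rez gerDl.
Qed.

End ComplexModulus.

(** * The complex Hahn-Banach theorem *)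

Section ComplexHahnBanach.
Variables (R : realType) (V : lmodType R[i]) (p : V -> R).
Hypotheses (p_subadd : forall x y, p (x + y) <= p x + p y)
  (p_homog : forall (a : R[i]) x, p (a *: x) = normc a * p x).

(** A complex functional is recovered from its real part [l] as [l x - i l (i x)]. Multiplying [x]
    by the conjugate of [phi x] makes the value real, which turns [l <= p] into a bound on the
    modulus. *)
Lemma hahn_banach (x0 : V) : exists phi : {linear V -> (R[i])^o},
  (forall x, normc (phi x) <= p x) /\ phi x0 = ((p x0)%:C)%C.
Proof.
have ps : sublinear p.
  by split=> // t x t0; rewrite p_homog normc_real ger0_norm.
have [l [lD lZ lp lx0]] := hahn_banach_real x0 ps.
have lE (a : R[i]) x : l (a *: x) = re a * l x + im a * l ('i%C *: x).
  rewrite {1}[a]complexE scalerDl lD lZ; congr (_ + _).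
  by rewrite mulrC -scalerA lZ.
pose phi0 (x : V) : (R[i])^o := (l x +i* - l ('i%C *: x))%C.
have phi_lin : linear phi0.
  move=> a x y; have lii z : l ('i%C *: ('i%C *: z)) = - l z.
    by rewrite scalerA -expr2 sqr_i -[-1]/(- (1%:C)%C) -rmorphN lZ mulN1r.
  apply: complexP; rewrite /phi0 /=.
    by rewrite lD [l (a *: x)]lE reD /= reM /=; ring.
  rewrite scalerDr lD scalerA mulrC -scalerA [l (a *: _)]lE lii imD imM /=; ring.
pose Phi : {linear V -> (R[i])^o} :=
  HB.pack phi0 (GRing.isLinear.Build _ _ _ _ phi0 phi_lin).
have Phip x : normc (Phi x) <= p x.
  have [->|z0] := eqVneq (Phi x) 0.
    by rewrite normc_real normr0 -[leLHS](sublinear0 ps); have := sublinear_opp x ps;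
      rewrite -scaleN1r p_homog -[-1]/(- (1%:C)%C) -rmorphN normc_real
        normrN1 mul1r (sublinear0 ps); lra.
  have n0 : 0 < normc (Phi x).
    by rewrite lt_def normc_ge0 andbT; apply: contra z0 => /eqP/Normc.eq0_normc ->.
  rewrite -(ler_pM2l n0) -expr2 normc_sqr.
  pose a : R[i] := (re (Phi x) -i* im (Phi x))%C.
  have -> : normc (Phi x) = normc a by rewrite /= !sqrrN.
  rewrite -p_homog; apply: le_trans (lp _); rewrite lE /a /=.
  by rewrite !expr2; lra.
exists Phi; split=> //.
by apply: normc_le_re; [exact: Phip | exact: lx0].
Qed.
End ComplexHahnBanach.

(** * Goursat's theorem for real 1-forms *)

Section Goursat.
Variable R : realType.

(** The intervals [[x n, x n + w / 2 ^ n]] are nested; the supremum of their left endpoints lies in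
    all of them. *)
Lemma nested_halving (x : nat -> R) (w : R) :
  (forall n, x n <= x n.+1 <= x n + w / 2 ^+ n.+1) ->
  exists l, forall n, x n <= l <= x n + w / 2 ^+ n.
Proof.
move=> xn.
have half n : w / 2 ^+ n = w / 2 ^+ n.+1 + w / 2 ^+ n.+1.
  by rewrite exprS invfM mulrCA -mulrDl -[X in _ = (X + X) * _]mul1r -splitr mul1r.
have mono m n : (m <= n)%N -> x m <= x n /\ x n + w / 2 ^+ n <= x m + w / 2 ^+ m.
  move=> /subnK <-; elim: (n - m)%N => [|k [ih1 ih2]]; first by rewrite add0n.
  rewrite addSn; have /andP[h1 h2] := xn (k + m)%N; have := half (k + m)%N; lra.
have xub k n : x k <= x n + w / 2 ^+ n.
  have w0 : 0 <= w / 2 ^+ k by have /andP[] := xn k; have := half k; lra.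
  have [kn|/ltnW nk] := leqP k n; last by have [] := mono _ _ nk; lra.
  have [] := mono _ _ kn.
  have : 0 <= w / 2 ^+ n by have /andP[] := xn n; have := half n; lra.
  lra.
exists (sup (range x)) => n; apply/andP; split.
  by apply: ub_le_sup; [exists (x 0%N + w / 2 ^+ 0) => _ [k _ <-]; exact: xub | exists n].
by apply: ge_sup; [exists (x 0%N), 0%N | move=> _ [k _ <-]; exact: xub].
Qed.

(** The increment of [F] over the rectangle [[a, b] x [c, d]], additive under subdivision. *)
Definition double_diff (F : R -> R -> R) (a b c d : R) : R :=
  F b d - F b c - F a d + F a c.

(** Goursat's bisection: one quarter of each rectangle keeps at least a quarter of a nonzero
    increment, which the local estimate at the common limit point contradicts. *)
Lemma double_diff_local0 (F : R -> R -> R) (a b c d : R) : a <= b -> c <= d ->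
  (forall x y, a <= x <= b -> c <= y <= d -> forall e : R, 0 < e ->
    exists2 dl : R, 0 < dl & forall a' b' c' d',
      a' <= x <= b' -> c' <= y <= d' -> a <= a' -> b' <= b -> c <= c' -> d' <= d ->
      b' - a' < dl -> d' - c' < dl ->
      `|double_diff F a' b' c' d'| <= e * (b' - a' + (d' - c')) ^+ 2) ->
  double_diff F a b c d = 0.
Proof.
move=> ab cd loc; apply/eqP/negPn/negP => nz.
pose mu := `|double_diff F a b c d|; have mu0 : 0 < mu by rewrite normr_gt0.
pose w n : R := (b - a) / 2 ^+ n; pose h n : R := (d - c) / 2 ^+ n.
have halfw n : w n = w n.+1 + w n.+1.
  by rewrite /w exprS invfM mulrCA -mulrDl -[X in _ = (X + X) * _]mul1r -splitr mul1r.
have halfh n : h n = h n.+1 + h n.+1.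
  by rewrite /h exprS invfM mulrCA -mulrDl -[X in _ = (X + X) * _]mul1r -splitr mul1r.
have w0 n : 0 <= w n by rewrite divr_ge0 ?exprn_ge0 // subr_ge0.
have h0 n : 0 <= h n by rewrite divr_ge0 ?exprn_ge0 // subr_ge0.
pose D n (p : R * R) := `|double_diff F p.1 (p.1 + w n) p.2 (p.2 + h n)|.
(* Putting the lower bound inside as an implication makes the claim valid for every rectangle, so
   that [choice] yields a selection function. [p'] is the lower left corner of the retained
   quarter. *)
have step (np : nat * (R * R)) : exists p' : R * R, let n := np.1 in let p := np.2 in
    [/\ p.1 <= p'.1 <= p.1 + w n.+1, p.2 <= p'.2 <= p.2 + h n.+1 &
      mu / 4 ^+ n <= D n p -> mu / 4 ^+ n.+1 <= D n.+1 p'].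
  case: np => n [x y] /=; set m := mu / 4 ^+ n.+1.
  have mE : mu / 4 ^+ n = m + m + (m + m).
    rewrite /m exprS invfM; field; by rewrite expf_neq0.
  have [q qP [q1 q2]] : exists2 q : R * R, mu / 4 ^+ n <= D n (x, y) -> m <= D n.+1 q &
      x <= q.1 <= x + w n.+1 /\ y <= q.2 <= y + h n.+1.
    have [/= D1|D1] := leP m (D n.+1 (x, y)).
      by exists (x, y) => //=; rewrite !lexx !lerDl w0 h0.
    have [/= D2|D2] := leP m (D n.+1 (x + w n.+1, y)).
      by exists (x + w n.+1, y) => //=; rewrite !lexx !lerDl w0 h0.
    have [/= D3|D3] := leP m (D n.+1 (x, y + h n.+1)).
      by exists (x, y + h n.+1) => //=; rewrite !lexx !lerDl w0 h0.
    exists (x + w n.+1, y + h n.+1) => /=; last by rewrite !lexx !lerDl w0 h0.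
    rewrite mE; move: D1 D2 D3; rewrite /D /double_diff /= (halfw n) (halfh n).
    rewrite !addrA !ltr_norml.
    move=> /andP[A1 A2] /andP[A3 A4] /andP[A5 A6].
    rewrite !ler_normr => /orP[A7|A7]; apply/orP; [left|right]; lra.
  by exists q.
have [S SP] := choice step.
pose fix z n := if n is k.+1 then S (k, z k) else (a, c).
have zD n : mu / 4 ^+ n <= D n (z n).
  elim: n => [|n ih]; last by have [_ _] := SP (n, z n); exact.
  by rewrite /D /= !expr0 divr1 /w /h !expr0 !divr1 !subrKC.
have [|x xP] := @nested_halving (fun n => (z n).1) (b - a).
  by move=> n; have [] := SP (n, z n).
have [|y yP] := @nested_halving (fun n => (z n).2) (d - c).
  by move=> n; have [] := SP (n, z n).
have inx n : a <= (z n).1 /\ (z n).1 + w n <= b.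
  elim: n => [|n [ih1 ih2]]; first by rewrite /= /w expr0 divr1 subrKC.
  have [/= /andP[]] := SP (n, z n); have := halfw n; lra.
have iny n : c <= (z n).2 /\ (z n).2 + h n <= d.
  elim: n => [|n [ih1 ih2]]; first by rewrite /= /h expr0 divr1 subrKC.
  have [/= _ /andP[]] := SP (n, z n); have := halfh n; lra.
(* The [+ 1] keeps [K] positive for degenerate rectangles; with [e := mu / (2 * K ^+ 2)] the local
   bound at stage [n] is at most half of [mu / 4 ^+ n]. *)
pose K := b - a + (d - c) + 1; have K0 : 0 < K by rewrite /K; lra.
have e0 : 0 < mu / (2 * K ^+ 2) by rewrite divr_gt0 // mulr_gt0 // exprn_gt0.
have abx : a <= x <= b.
  by have := xP 0%N; rewrite /= expr0 divr1 subrKC.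
have cdy : c <= y <= d.
  by have := yP 0%N; rewrite /= expr0 divr1 subrKC.
have [dl dl0 dlP] := loc x y abx cdy _ e0.
have [n nP] : exists n, K / 2 ^+ n < dl.
  exists (Num.trunc (K / dl)).+1.
  rewrite ltr_pdivrMr ?exprn_gt0 // mulrC -ltr_pdivrMr //.
  apply: lt_trans (truncnS_gt _) _.
  by rewrite -natrX ltr_nat ltn_expl.
have wn : w n < dl.
  by apply: le_lt_trans nP; rewrite ler_pM2r ?invr_gt0 ?exprn_gt0 // /K; lra.
have hn : h n < dl.
  by apply: le_lt_trans nP; rewrite ler_pM2r ?invr_gt0 ?exprn_gt0 // /K; lra.
have := dlP (z n).1 ((z n).1 + w n) (z n).2 ((z n).2 + h n) (xP n) (yP n)
  (inx n).1 (inx n).2 (iny n).1 (iny n).2.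
have dK (u v : R) : u + v - u = v by rewrite addrAC subrr add0r.
rewrite !dK => /(_ wn hn) /(le_trans (zD n)).
apply/negP; rewrite -ltNge /w /h -mulrDl.
set T := b - a + (d - c).
have -> : mu / (2 * K ^+ 2) * (T / 2 ^+ n) ^+ 2 = mu / 4 ^+ n * (T ^+ 2 / (2 * K ^+ 2)).
  rewrite (_ : 4 = 2 ^+ 2 :> R); last by rewrite expr2; ring.
  rewrite exprAC; field; rewrite expf_neq0 //=; lra.
rewrite -[ltRHS]mulr1 ltr_pM2l; last by rewrite divr_gt0 // exprn_gt0.
rewrite ltr_pdivrMr ?mulr_gt0 ?exprn_gt0 // mul1r.
have : T ^+ 2 <= K ^+ 2 by rewrite lerXn2r ?nnegrE /T /K; lra.
have : 0 < K ^+ 2 by rewrite exprn_gt0.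
lra.
Qed.

End Goursat.

(** * Closed 1-forms on rectangles *)

Section ClosedForm.
Variable R : realType.

Lemma mean_value_eq (f df : R -> R) (a b : R) : a <= b ->
  (forall x, a <= x <= b -> is_derive x 1 f (df x)) ->
  exists2 c, a <= c <= b & f b - f a = df c * (b - a).
Proof.
move=> ab fd.
have [||c cab ->] := @MVT_segment R f df a b ab.
- by move=> x; rewrite in_itv /= => /andP[/ltW h1 /ltW h2]; apply: fd; rewrite h1 h2.
- apply: derivable_within_continuous => x; rewrite in_itv /= => xab.
  exact: (@ex_derive _ _ _ _ _ _ _ (fd x xab)).
by exists c => //; move: cab; rewrite in_itv.
Qed.

Definition has_differential2 (P : R -> R -> R) (x y a b : R) : Prop :=
  forall e : R, 0 < e -> exists2 dl : R, 0 < dl & forall s t, `|s - x| < dl -> `|t - y| < dl ->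
    `|P s t - P x y - a * (s - x) - b * (t - y)| <= e * (`|s - x| + `|t - y|).

Lemma dist_in_segment (r r' z z' : R) :
  r <= z <= r' -> r <= z' <= r' -> `|z' - z| <= r' - r.
Proof.
by move=> /andP[? ?] /andP[? ?]; rewrite ler_norml; apply/andP; split; lra.
Qed.

Lemma sub_segment (a a' b b' x : R) :
  a <= a' -> b' <= b -> a' <= x <= b' -> a <= x <= b.
Proof. by move=> aa bb /andP[? ?]; rewrite (le_trans aa) // (le_trans _ bb). Qed.

(** For two first-order expansions at one point, the base value [w] and the shared linear term [v]
    cancel in the difference. *)
Lemma difference_estimate (u u' w l l' v e : R) :
  `|u - w - l - v| <= e / 4 -> `|u' - w - l' - v| <= e / 4 ->
  `|u - u' - (l - l')| <= e / 2.
Proof.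
rewrite !ler_norml => /andP[? ?] /andP[? ?]; apply/andP; split; lra.
Qed.

(* Cauchy-Goursat for the 1-form [P dx + Q dy]: with [A], [B] partial
   antiderivatives of [P], [Q], its integral around the boundary of
   [[a, b] x [c, d]] is the double difference of [B - A]. *)
Lemma closed_form_double_diff0 (P Q A B : R -> R -> R) (a b c d : R) :
  a <= b -> c <= d ->
  (forall x y, a <= x <= b -> c <= y <= d -> is_derive x 1 (A ^~ y) (P x y)) ->
  (forall x y, a <= x <= b -> c <= y <= d -> is_derive y 1 (B x) (Q x y)) ->
  (forall x y, a <= x <= b -> c <= y <= d -> exists k k1 k2,
     has_differential2 Q x y k k1 /\ has_differential2 P x y k2 k) ->
  double_diff (fun x y => B x y - A x y) a b c d = 0.
Proof.
move=> ab cd dA dB dPQ; apply: double_diff_local0 => // x y xab ycd e e0.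
(* The shared coefficient [k] expresses closedness: [dQ/dx = dP/dy]. *)
have [k [k1 [k2 [dQ dP]]]] := dPQ x y xab ycd.
have e4 : 0 < e / 4 by rewrite divr_gt0.
have [dl1 dl10 {}dQ] := dQ _ e4; have [dl2 dl20 {}dP] := dP _ e4.
exists (Num.min dl1 dl2); first by rewrite lt_min dl10.
move=> a' b' c' d' xab' ycd' aa bb cc dd.
rewrite !lt_min => /andP[w1 w2] /andP[h1 h2].
have ab' : a' <= b' by case/andP: xab'; exact: le_trans.
have cd' : c' <= d' by case/andP: ycd'; exact: le_trans.
have a'in : a' <= a' <= b' by rewrite lexx.
have b'in : a' <= b' <= b' by rewrite lexx ab'.
have c'in : c' <= c' <= d' by rewrite lexx.
have d'in : c' <= d' <= d' by rewrite lexx cd'.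
(* Applied to the difference of the two vertical sides, the mean value theorem evaluates [Q] on both
   at one common height [u]; likewise [v] for the horizontal sides. *)
have [|u u' Eu] := @mean_value_eq (fun t => B b' t - B a' t)
    (fun t => Q b' t - Q a' t) c' d' cd'.
  by move=> t td; apply: is_deriveB; apply: dB; exact: sub_segment td || exact: sub_segment aa bb _.
have [|v v' Ev] := @mean_value_eq (fun s => A s d' - A s c')
    (fun s => P s d' - P s c') a' b' ab'.
  by move=> s sd; apply: is_deriveB; apply: dA; exact: sub_segment sd || exact: sub_segment cc dd _.
have -> : double_diff (fun x y => B x y - A x y) a' b' c' d' =
    (Q b' u - Q a' u) * (d' - c') - (P v d' - P v c') * (b' - a').
  by rewrite -Eu -Ev /double_diff; ring.
clear dA dB dPQ Eu Ev.
set S := b' - a' + (d' - c').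
have bx := dist_in_segment xab' b'in.
have ax := dist_in_segment xab' a'in.
have vx := dist_in_segment xab' v'.
have uy := dist_in_segment ycd' u'.
have dy := dist_in_segment ycd' d'in.
have cy := dist_in_segment ycd' c'in.
have mon (z z' : R) : z <= b' - a' -> z' <= d' - c' -> e / 4 * (z + z') <= e * S / 4.
  by move=> ? ?; rewrite mulrAC ler_pM2r ?invr_gt0 ?ltr0n // ler_pM2l // /S lerD.
have Q1 := le_trans (dQ _ _ (le_lt_trans bx w1) (le_lt_trans uy h1)) (mon _ _ bx uy).
have Q2 := le_trans (dQ _ _ (le_lt_trans ax w1) (le_lt_trans uy h1)) (mon _ _ ax uy).
have P1 := le_trans (dP _ _ (le_lt_trans vx w2) (le_lt_trans dy h2)) (mon _ _ vx dy).
have P2 := le_trans (dP _ _ (le_lt_trans vx w2) (le_lt_trans cy h2)) (mon _ _ vx cy).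
have := difference_estimate Q1 Q2.
rewrite addrAC in P1; rewrite addrAC in P2.
have := difference_estimate P1 P2.
have kE (z z' z'' : R) : k * (z - z'') - k * (z' - z'') = k * (z - z') by ring.
rewrite !kE; set q := Q b' u - Q a' u - _; set r := P v d' - P v c' - _ => rE qE.
(* The leading terms [k * (b' - a') * (d' - c')] cancel, leaving only the remainders [q] and [r]. *)
have -> : (Q b' u - Q a' u) * (d' - c') - (P v d' - P v c') * (b' - a') =
    q * (d' - c') - r * (b' - a') by rewrite /q /r; ring.
apply: le_trans (ler_normB _ _) _; rewrite !normrM.
have w0 : 0 <= b' - a' by rewrite subr_ge0.
have h0 : 0 <= d' - c' by rewrite subr_ge0.
rewrite (ger0_norm w0) (ger0_norm h0).
have -> : e * S ^+ 2 = e * S / 2 * S + e * S / 2 * S by field.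
by apply: lerD; apply: ler_pM => //; rewrite /S ?lerDl ?lerDr.
Qed.

Lemma is_derive_parameterized_integral (f : R -> R) (a b : R) :
  {within `[a, b], continuous f} -> forall x, a < x -> x < b ->
  is_derive x 1 (fun y => parameterized_integral (@lebesgue_measure R) a y f) (f x).
Proof.
move=> cf x ax xb.
have ab : a < b by exact: lt_trans xb.
have [|||D E] := @continuous_FTC1_closed R f a x b xb.
- by apply: continuous_compact_integrable => //; exact: segment_compact.
- by [].
- by apply: (within_continuous_continuous ab cf); rewrite in_itv /= ax.
exact: (DeriveDef D (etrans (esym (derive1E _ _)) E)).
Qed.

End ClosedForm.

(** * Complex differentiability in polar coordinates *)

(** The general field [K] lets this serve complex and real derivatives alike. *)
Lemma derivable_expansion (K : numFieldType) (f : K^o -> K^o) (x : K^o) :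
  derivable f x 1 -> forall e : K, 0 < e -> exists2 dl : K, 0 < dl &
    forall y, `|y - x| < dl -> `|f y - f x - 'D_1 f x * (y - x)| <= e * `|y - x|.
Proof.
move=> /derivable_nbhs /eqaddoP fx e e0.
have /nbhs_ballP[dl /= dl0 dlP] := fx e e0; exists dl => // y yx.
have := dlP (y - x); rewrite -ball_normE /= sub0r normrN => /(_ yx).
rewrite !fctE /cst /= [_ *: 1]mulr1 subrK opprD addrA.
by rewrite [_ *: _]mulrC.
Qed.

Section Holomorphic.
Variable R : realType.
Local Notation C := R[i].
Implicit Types (h : C -> C) (z w d : C).

(** The remainder estimate is real-valued, which avoids the partial order on the complex numbers. *)
Definition cdiff h z d : Prop :=
  forall e : R, 0 < e -> exists2 dl : R, 0 < dl & forall w, normc (w - z) < dl ->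
    normc (h w - h z - d * (w - z)) <= e * normc (w - z).

Definition holo (z0 : C) (r : R) h : Prop :=
  forall z, normc (z - z0) < r -> exists d, cdiff h z d.

Lemma normE z : `|z| = ((normc z)%:C)%C :> C. Proof. by []. Qed.

Lemma gt0_complex z : 0 < z -> 0 < re z /\ z = ((re z)%:C)%C.
Proof. by case: z => a b; rewrite ltcE /= => /andP[/eqP -> ->]. Qed.

Lemma derivable_cdiff h z : derivable (h : C^o -> C^o) z 1 -> exists d, cdiff h z d.
Proof.
move=> dh; exists ('D_1 (h : C^o -> C^o) z) => e e0.
have e0' : 0 < (e%:C)%C :> C by rewrite ltcR.
have [dl /gt0_complex[dl0 ->] dlP] := derivable_expansion dh e0'.
exists (re dl) => // w wz; have := dlP w.
by rewrite !normE ltcR -rmorphM lecR; exact.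
Qed.

Lemma normcB z w : normc (z - w) = normc (w - z).
Proof. by rewrite -normcN opprB. Qed.

Lemma cdiff_cvg h z d : cdiff h z d -> forall e : R, 0 < e ->
  exists2 dl : R, 0 < dl & forall w, normc (w - z) < dl -> normc (h w - h z) <= e.
Proof.
move=> hd e e0; have [dl dl0 dlP] := hd 1 ltr01.
have n0 : 0 < 1 + normc d by have := normc_ge0 d; lra.
exists (Num.min dl (e / (1 + normc d))); first by rewrite lt_min dl0 divr_gt0.
move=> w; rewrite lt_min => /andP[w1 w2]; have := dlP w w1.
rewrite ltr_pdivlMr // in w2.
have := le_normcD (h w - h z - d * (w - z)) (d * (w - z)).
rewrite subrK Normc.normcM; lra.
Qed.

Lemma cdiff_affine h z0 w z d : cdiff h (z0 + z * w) d ->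
  cdiff (fun l => h (z0 + l * w)) z (d * w).
Proof.
move=> hd e e0.
have n0 : 0 < normc w + 1 by have := normc_ge0 w; lra.
have e1 : 0 < e / (normc w + 1) by rewrite divr_gt0.
have [dl dl0 dlP] := hd _ e1.
exists (dl / (normc w + 1)); first by rewrite divr_gt0.
move=> l lz.
have E : z0 + l * w - (z0 + z * w) = (l - z) * w by ring.
have nle : normc ((l - z) * w) <= normc (l - z) * (normc w + 1).
  by rewrite Normc.normcM ler_wpM2l ?normc_ge0 // lerDl.
have := dlP (z0 + l * w); rewrite E => H.
rewrite -[d * w * _]mulrA [w * _]mulrC; apply: le_trans (H _) _.
  by apply: le_lt_trans nle _; rewrite -ltr_pdivlMr.
have -> : e * normc (l - z) = e / (normc w + 1) * (normc (l - z) * (normc w + 1)).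
  by field; lra.
by rewrite ler_pM2l.
Qed.

(** This is [exp (s + i t)]: with the logarithm of the radius as a coordinate the map is
    multiplicative and holomorphic in [s + i t]. *)
Definition polar (s t : R) : C := (expR s * cos t +i* (expR s * sin t))%C.

Lemma normc_polar s t : normc (polar s t) = expR s.
Proof.
by rewrite /= !exprMn -mulrDr cos2Dsin2 mulr1 sqrtr_sqr ger0_norm ?expR_ge0.
Qed.

Lemma polarD s t s' t' : polar (s + s') (t + t') = polar s t * polar s' t'.
Proof.
by apply: complexP; rewrite ?reM ?imM /= expRD ?cosD ?sinD; ring.
Qed.

Lemma normc_le_norm1 (x y : R) : normc (x +i* y)%C <= `|x| + `|y|.
Proof.
have -> : (x +i* y)%C = (x%:C)%C + 'i%C * (y%:C)%C by rewrite [LHS]complexE.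
apply: le_trans (le_normcD _ _) _; rewrite normc_real Normc.normcM normc_real.
by rewrite [normc 'i]/= expr0n /= expr1n add0r sqrtr1 mul1r.
Qed.

Lemma real_expansion (f : R -> R) (x d : R) : is_derive x 1 f d ->
  forall e : R, 0 < e -> exists2 dl : R, 0 < dl &
    forall y, `|y - x| < dl -> `|f y - f x - d * (y - x)| <= e * `|y - x|.
Proof. by move=> [fx <-] e e0; exact: (@derivable_expansion R f x fx e e0). Qed.

Lemma polar_expansion0 (e : R) : 0 < e -> exists2 dl : R, 0 < dl &
  forall s t, `|s| < dl -> `|t| < dl ->
    normc (polar s t - 1 - (s +i* t)%C) <= e * (`|s| + `|t|).
Proof.
move=> e0; have e5 : 0 < e / 5 by rewrite divr_gt0.
have [d0 d00 P0] := real_expansion (is_derive_expR 0) ltr01.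
have [d1 d10 P1] := real_expansion (is_derive_expR 0) e5.
have [d2 d20 P2] := real_expansion (is_derive_cos 0) e5.
have [d3 d30 P3] := real_expansion (is_derive_sin 0) e5.
(* The bound [2^-1] gives [|E| <= 2] and [e / 10] gives [|E - 1| <= e / 5]; the errors in [t] then
   add up to 2 + 2 + 1 fifths of [e]. *)
exists (Num.min (Num.min (Num.min d0 d1) (Num.min d2 d3)) (Num.min 2^-1 (e / 10))).
  rewrite !lt_min d00 d10 d20 d30 invr_gt0 ltr0n /=; lra.
move=> s t; rewrite !lt_min => /andP[/andP[/andP[s0 s1] _] /andP[s4 s5]].
move=> /andP[/andP[_ /andP[t2 t3]] _].
have := P0 s; have := P1 s; have := P2 t; have := P3 t.
rewrite !subr0 sin0 cos0 expR0 oppr0 mul0r !mul1r !subr0 addr0.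
move=> /(_ t3) Q3 /(_ t2) Q2 /(_ s1) Q1 /(_ s0) Q0.
rewrite /polar; set E := expR s in Q0 Q1 *.
have E1 : `|E - 1| <= 2 * `|s|.
  by rewrite -[E - 1](subrK s); apply: le_trans (ler_normD _ _) _; lra.
have E2 : `|E| <= 2.
  by rewrite -[E](subrK 1); apply: le_trans (ler_normD _ _) _; rewrite normr1; lra.
have -> : (E * cos t +i* (E * sin t))%C - 1 - (s +i* t)%C =
    ((E * (cos t - 1) + (E - 1 - s)) +i* (E * (sin t - t) + (E - 1) * t))%C.
  apply: complexP; rewrite !(reD, imD, reN, imN) /=; ring.
apply: le_trans (normc_le_norm1 _ _) _.
have h1 : `|E * (cos t - 1)| <= 2 * (e / 5 * `|t|) by rewrite normrM; apply: ler_pM.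
have h2 : `|E * (sin t - t)| <= 2 * (e / 5 * `|t|) by rewrite normrM; apply: ler_pM.
have h3 : `|(E - 1) * t| <= e / 5 * `|t|.
  rewrite normrM; by apply: ler_pM => //; lra.
have := ler_normD (E * (cos t - 1)) (E - 1 - s).
have := ler_normD (E * (sin t - t)) ((E - 1) * t).
have : 0 <= e * `|s| by rewrite mulr_ge0 ?(ltW e0).
lra.
Qed.

Lemma polar_expansion (s0 t0 e : R) : 0 < e -> exists2 dl : R, 0 < dl &
  forall s t, `|s - s0| < dl -> `|t - t0| < dl ->
    normc (polar s t - polar s0 t0 - polar s0 t0 * ((s - s0) +i* (t - t0))%C) <=
    e * (`|s - s0| + `|t - t0|).
Proof.
move=> e0; have E0 := expR_gt0 s0.
have [dl dl0 dlP] := polar_expansion0 (divr_gt0 e0 E0).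
exists dl => // s t sd td.
have -> : polar s t = polar s0 t0 * polar (s - s0) (t - t0).
  by rewrite -polarD !subrKC.
set L := polar s0 t0; set M := polar _ _; set N := (_ +i* _)%C.
have -> : L * M - L - L * N = L * (M - 1 - N) by ring.
rewrite Normc.normcM normc_polar.
have := dlP _ _ sd td; rewrite -(ler_pM2l E0) => /le_trans; apply.
by rewrite mulrA mulrCA mulfV ?mulr1 // gt_eqF.
Qed.

(** Chain rule: the exponential is its own derivative, whence the factor [polar s0 t0] in [k]. *)
Lemma cdiff_polar h (s0 t0 : R) d : cdiff h (polar s0 t0) d ->
  let k := d * polar s0 t0 in forall e : R, 0 < e -> exists2 dl : R, 0 < dl &
  forall s t, `|s - s0| < dl -> `|t - t0| < dl ->
    normc (h (polar s t) - h (polar s0 t0) - k * ((s - s0) +i* (t - t0))%C) <=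
    e * (`|s - s0| + `|t - t0|).
Proof.
move=> hd /= e e0; set L := polar s0 t0.
(* [M] bounds the growth of [polar] near the base point, by its expansion with error 1. *)
pose M := normc L + 1; have M0 : 0 < M by rewrite /M; have := normc_ge0 L; lra.
have N0 : 0 < normc d + 1 by have := normc_ge0 d; lra.
have e1 : 0 < e / (2 * M) by rewrite divr_gt0 // mulr_gt0.
have e2 : 0 < e / (2 * (normc d + 1)) by rewrite divr_gt0 // mulr_gt0.
have [d1 d10 P1] := hd _ e1.
have [d2 d20 P2] := polar_expansion s0 t0 e2.
have [d3 d30 P3] := polar_expansion s0 t0 (@ltr01 R).
exists (Num.min (Num.min d2 d3) (d1 / (2 * M))).
  by rewrite !lt_min d20 d30 divr_gt0 // mulr_gt0.
move=> s t; rewrite !lt_min => /andP[/andP[s2 s3] s1] /andP[/andP[t2 t3] t1].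
have := P2 _ _ s2 t2; have := P3 _ _ s3 t3; rewrite -/L.
set w := polar s t; set D := (_ +i* _)%C; set S := `|_| + `|_| => Q3 Q2.
have DS : normc D <= S by exact: normc_le_norm1.
have wL : normc (w - L) <= M * S.
  have := le_normcD (w - L - L * D) (L * D); rewrite subrK Normc.normcM => /le_trans; apply.
  rewrite /M mulrDl addrC lerD // ler_wpM2l ?normc_ge0 //.
have Sd : M * S < d1.
  rewrite mulrC -ltr_pdivlMr //.
  have -> : d1 / M = d1 / (2 * M) + d1 / (2 * M) by field; lra.
  by rewrite /S ltrD.
have Q1 := P1 w (le_lt_trans wL Sd); rewrite -/L in Q1.
have -> : h w - h L - d * L * D = (h w - h L - d * (w - L)) + d * (w - L - L * D) by ring.
apply: le_trans (le_normcD _ _) _; rewrite Normc.normcM.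
have -> : e * S = e / (2 * M) * (M * S) + (normc d + 1) * (e / (2 * (normc d + 1)) * S).
  by field; lra.
apply: lerD; first by apply: le_trans Q1 _; rewrite ler_pM2l.
apply: ler_pM; rewrite ?normc_ge0 //; lra.
Qed.

(** The coefficients here and in [differential2_im] are the Cauchy-Riemann relations, which make
    [im h ds + re h dt] closed. *)
Lemma differential2_re h (s0 t0 : R) d : cdiff h (polar s0 t0) d ->
  has_differential2 (fun s t => re (h (polar s t))) s0 t0
    (re (d * polar s0 t0)) (- im (d * polar s0 t0)).
Proof.
move=> /cdiff_polar; set k := d * _ => hd e e0; have [dl dl0 dlP] := hd e e0.
exists dl => // s t sd td; apply: le_trans (dlP s t sd td).
apply: le_trans (re_le_normc _); rewrite !(reD, reN) [re (k * _)]reM /=.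
by rewrite le_eqVlt; apply/orP; left; apply/eqP; congr `|_|; ring.
Qed.

Lemma differential2_im h (s0 t0 : R) d : cdiff h (polar s0 t0) d ->
  has_differential2 (fun s t => im (h (polar s t))) s0 t0
    (im (d * polar s0 t0)) (re (d * polar s0 t0)).
Proof.
move=> /cdiff_polar; set k := d * _ => hd e e0; have [dl dl0 dlP] := hd e e0.
exists dl => // s t sd td; apply: le_trans (dlP s t sd td).
apply: le_trans (im_le_normc _); rewrite !(imD, imN) [im (k * _)]imM /=.
by rewrite le_eqVlt; apply/orP; left; apply/eqP; congr `|_|; ring.
Qed.

End Holomorphic.

(** * The maximum principle *)

Section MaximumPrinciple.
Variable R : realType.
Local Notation C := R[i].
Implicit Types (h : C -> C) (z w d : C).

Lemma linear_bound_continuous (f : R -> R) (x dl K : R) : 0 < dl -> 0 < K ->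
  (forall y, `|y - x| < dl -> `|f y - f x| <= K * `|y - x|) -> {for x, continuous f}.
Proof.
move=> dl0 K0 fK; apply/cvgrPdist_le => e e0.
apply/nbhs_ballP; exists (Num.min dl (e / K)); first by rewrite /= lt_min dl0 divr_gt0.
move=> y /=; rewrite distrC lt_min => /andP[y1 y2].
rewrite distrC; apply: le_trans (fK _ y1) _.
by rewrite mulrC -ler_pdivlMr // ltW.
Qed.

Lemma differential2_continuous_l (P : R -> R -> R) x y a b :
  has_differential2 P x y a b -> {for x, continuous (P ^~ y)}.
Proof.
move=> /(_ 1 ltr01)[dl dl0 dlP].
apply: (@linear_bound_continuous _ _ dl (1 + `|a|)) => // s sx.
have := dlP s y sx; rewrite subrr normr0 mulr0 subr0 addr0 mul1r => /(_ dl0) h.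
rewrite -[P s y - P x y](subrK (a * (s - x))); apply: le_trans (ler_normD _ _) _.
by rewrite normrM mulrDl mul1r lerD.
Qed.

Lemma differential2_continuous_r (P : R -> R -> R) x y a b :
  has_differential2 P x y a b -> {for y, continuous (P x)}.
Proof.
move=> /(_ 1 ltr01)[dl dl0 dlP].
apply: (@linear_bound_continuous _ _ dl (1 + `|b|)) => // s sx.
have := dlP x s; rewrite subrr normr0 mulr0 subr0 add0r mul1r => /(_ dl0 sx) h.
rewrite -[P x s - P x y](subrK (b * (s - y))); apply: le_trans (ler_normD _ _) _.
by rewrite normrM mulrDl mul1r lerD.
Qed.

(** The form [im h ds + re h dt] is the imaginary part of [h dz / z]. As it is closed, [re h] has
    the same integral over the unit circle as over a small circle, where it is within [e] of
    [re (h 0)]. *)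
Lemma polar_circle_mean h (r e : R) : 1 < r -> holo 0 r h -> 0 < e ->
  exists2 F : R -> R,
    forall t, - pi <= t <= pi -> is_derive t 1 F (re (h (polar 0 t))) &
    (re (h 0) - e) * (2 * pi) <= F pi - F (- pi).
Proof.
move=> r1 hh e0.
pose u s t := re (h (polar s t)); pose v s t := im (h (polar s t)).
have r0 : 0 < r by lra.
have lnr : 0 < ln r by rewrite ln_gt0.
have [d0 hd0] : exists d, cdiff h 0 d.
  by apply: hh; rewrite subrr normc_real normr0.
have [dl dl0 dlP] := cdiff_cvg hd0 e0.
have m0 : 0 < Num.min (dl / 2) 1 by rewrite lt_min divr_gt0 //=.
(* The logarithm of the small radius; the cap at 1 ensures [s1 <= 0]. *)
pose s1 := ln (Num.min (dl / 2) 1).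
have s10 : s1 <= 0 by rewrite ln_le0 // ge_min lexx orbT.
have near0 t : re (h 0) - e <= u s1 t.
  have := dlP (polar s1 t); rewrite subr0 normc_polar lnK ?posrE //.
  rewrite gt_min; have -> : dl / 2 < dl by rewrite ltr_pdivrMr // ltr_pMr // ltr1n.
  move=> /(_ isT) H; have := le_trans (re_le_normc _) H.
  by rewrite reD reN ler_norml /u => /andP[? _]; lra.
have dh s t : s < ln r -> exists d, cdiff h (polar s t) d.
  by move=> sr; apply: hh; rewrite subr0 normc_polar -(@lnK _ r) ?posrE // ltr_expR.
(* These endpoints put [[s1, 0]] in the interior of [[al, be]], where the integral can be
   differentiated, while [be < ln r] stays in the domain of [h]. *)
pose al := s1 - 1; pose be := ln r / 2.
have ber : be < ln r by rewrite /be; lra.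
have pi0 : 0 < pi :> R by exact: pi_gt0.
have [B dB] : exists B : R -> R -> R, forall s t, s < ln r -> - pi <= t <= pi ->
    is_derive t 1 (B s) (u s t).
  exists (fun s t => parameterized_integral lebesgue_measure (- pi - 1) t (u s)).
  move=> s t sr /andP[t1 t2].
  apply: (@is_derive_parameterized_integral _ _ _ (pi + 1)); last 2 first.
  - by lra.
  - by lra.
  apply: continuous_subspaceT => x; have [d hd] := dh s x sr.
  exact: differential2_continuous_r (differential2_re hd).
(* All integrals start at the same [al], so the equality of the integrands at [pi] and [- pi] passes
   to [A], and these two sides cancel. *)
have [A dA Api] : exists2 A : R -> R -> R, forall s t, s1 <= s <= 0 ->
    is_derive s 1 (A ^~ t) (v s t) & forall s, A s pi = A s (- pi).
  exists (fun s t => parameterized_integral lebesgue_measure al s (v ^~ t)) => [s t|s].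
    move=> /andP[sa sb]; apply: (@is_derive_parameterized_integral _ _ _ be).
    - apply: continuous_in_subspaceT => x; rewrite inE /= in_itv /= => /andP[_ xb].
      have [d hd] := dh x t (le_lt_trans xb ber).
      exact: differential2_continuous_l (differential2_im hd).
    - by rewrite /al; lra.
    - by rewrite /be; lra.
  congr parameterized_integral; apply/funext => x.
  by rewrite /v /polar cosN sinN sinpi oppr0.
exists (B 0) => [t tpi|]; first exact: dB.
have pipi : - pi <= pi :> R by lra.
have E : double_diff (fun s t => B s t - A s t) s1 0 (- pi) pi = 0.
  apply: (@closed_form_double_diff0 _ v u A B s1 0 (- pi) pi s10 pipi) => s t.
  - by move=> ? _; exact: dA.
  - by move=> /andP[_ s0] ?; apply: dB => //; exact: le_lt_trans s0 _.
  - move=> /andP[_ s0] _; have [d hd] := dh s t (le_lt_trans s0 lnr).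
    exists (re (d * polar s t)), (- im (d * polar s t)), (im (d * polar s t)).
    by split; [exact: differential2_re | exact: differential2_im].
rewrite /double_diff !Api in E.
have -> : B 0 pi - B 0 (- pi) = B s1 pi - B s1 (- pi) by lra.
have [|t _ ->] := @mean_value_eq _ (B s1) (u s1) _ _ pipi.
  by move=> t tpi; apply: dB => //; exact: le_lt_trans s10 _.
have -> : pi - - pi = 2 * pi :> R by ring.
by rewrite ler_pM2r ?near0 // mulr_gt0.
Qed.

(** If [re (h 1)] were smaller, then by continuity an arc [[0, del]] of the unit circle would pull
    the mean below [re (h 0)]. *)
Lemma unit_strong_max h (r : R) : 1 < r -> holo 0 r h ->
  (forall z, normc z < r -> re (h z) <= re (h 0)) -> re (h 1) = re (h 0).
Proof.
move=> r1 hh hmax; apply/eqP/negPn/negP => ne.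
have polar01 : polar 0 0 = 1 :> C.
  by apply: complexP; rewrite /= ?expR0 ?cos0 ?sin0 mul1r.
set m := re (h 0) in hmax ne *.
have hm t : re (h (polar 0 t)) <= m.
  by apply: hmax; rewrite normc_polar expR0.
have eta : 0 < m - re (h 1).
  by rewrite subr_gt0 lt_neqAle ne -polar01 hm.
set eta0 := m - _ in eta.
have [d1 hd1] : exists d, cdiff h (polar 0 0) d.
  by apply: hh; rewrite subr0 normc_polar expR0.
have := differential2_continuous_r (differential2_re hd1).
move=> /cvgrPdist_le /(_ (eta0 / 2)) []; first by rewrite divr_gt0.
move=> dl /= dl0 dlP.
have pi0 : 0 < pi :> R by exact: pi_gt0.
pose del := Num.min (dl / 2) pi.
have del0 : 0 < del by rewrite lt_min divr_gt0.
have depi : del <= pi by rewrite ge_min lexx orbT.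
have deldl : del < dl by rewrite gt_min; apply/orP; left; lra.
(* Over the whole circle this error costs [eta0 * del / 4], less than the deficit [eta0 * del / 2]
   on the arc. *)
have e0 : 0 < eta0 * del / (8 * pi) by rewrite divr_gt0 ?mulr_gt0.
have [F dF] := polar_circle_mean r1 hh e0.
have -> : (re (h 0) - eta0 * del / (8 * pi)) * (2 * pi) = m * (2 * pi) - eta0 * del / 4.
  by rewrite /m; field; lra.
have [||t1 _ E1] := @mean_value_eq _ F (fun t => re (h (polar 0 t))) (- pi) 0.
- by lra.
- by move=> t /andP[? ?]; apply: dF; lra.
have [||t2 /andP[t20 t2d] E2] := @mean_value_eq _ F (fun t => re (h (polar 0 t))) 0 del.
- by lra.
- by move=> t /andP[? ?]; apply: dF; lra.
have [|t3 _ E3] := @mean_value_eq _ F (fun t => re (h (polar 0 t))) del pi depi.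
- by move=> t /andP[? ?]; apply: dF; lra.
have b1 : F 0 - F (- pi) <= m * (0 - - pi).
  by rewrite E1 ler_wpM2r ?hm //; lra.
have b3 : F pi - F del <= m * (pi - del).
  by rewrite E3 ler_wpM2r ?hm //; lra.
have ht2 : re (h (polar 0 t2)) <= m - eta0 / 2.
  have := dlP t2; rewrite /= sub0r normrN (ger0_norm t20) => /(_ (le_lt_trans t2d deldl)).
  by rewrite polar01 ler_norml /eta0 => /andP[? ?]; lra.
have b2 : F del - F 0 <= (m - eta0 / 2) * (del - 0).
  by rewrite E2 ler_wpM2r //; lra.
have : 0 < eta0 * del by rewrite mulr_gt0.
clear - b1 b2 b3; move: b1 b2 b3; lra.
Qed.

(** The substitution [z0 + l * (z - z0)] moves [z] to 1 and the radius to
    [r / normc (z - z0) > 1]. *)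
Lemma strong_max h z0 (r : R) : holo z0 r h ->
  (forall z, normc (z - z0) < r -> re (h z) <= re (h z0)) ->
  forall z, normc (z - z0) < r -> re (h z) = re (h z0).
Proof.
move=> hh hmax z zr.
have [->//|zz0] := eqVneq z z0.
have n0 : 0 < normc (z - z0).
  rewrite lt_def normc_ge0 andbT; apply: contra zz0 => /eqP/Normc.eq0_normc/eqP.
  by rewrite subr_eq0.
pose w := z - z0.
have bnd l : normc (l - 0) < r / normc w -> normc (z0 + l * w - z0) < r.
  by rewrite subr0 addrAC subrr add0r Normc.normcM ltr_pdivlMr.
have := @unit_strong_max (fun l => h (z0 + l * w)) (r / normc w).
rewrite mul1r mul0r addr0 subrKC; apply.
- by rewrite ltr_pdivlMr // mul1r.
- move=> l lr; have [d hd] := hh _ (bnd l lr).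
  by exists (d * w); exact: cdiff_affine.
- by move=> l lr; apply: hmax; apply: bnd; rewrite subr0.
Qed.

(** Multiplication by the conjugate [a] of [h z0] makes the value at [z0] real and nonnegative,
    reducing the modulus to the real part. *)
Lemma strong_max_modulus h z0 (r : R) : holo z0 r h ->
  (forall z, normc (z - z0) < r -> normc (h z) <= normc (h z0)) ->
  forall z, normc (z - z0) < r -> normc (h z) = normc (h z0).
Proof.
move=> hh hmax z zr.
have r0 : 0 < r by apply: le_lt_trans zr; exact: normc_ge0.
pose a : C := (re (h z0) -i* im (h z0))%C.
have na : normc a = normc (h z0) by rewrite /a; case: (h z0) => ? ? /=; rewrite sqrrN.
have aE : a * h z0 = ((normc (h z0) ^+ 2)%:C)%C.
  by apply: complexP; rewrite ?reM ?imM /= ?normc_sqr; ring.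
have hh' : holo z0 r (fun z => a * h z).
  move=> x xr; have [d hd] := hh x xr; exists (a * d) => e e0.
  have n1 : 0 < normc a + 1 by have := normc_ge0 a; lra.
  have [dl dl0 dlP] := hd _ (divr_gt0 e0 n1); exists dl => // y yx.
  have -> : a * h y - a * h x - a * d * (y - x) = a * (h y - h x - d * (y - x)) by ring.
  have -> : e * normc (y - x) = (normc a + 1) * (e / (normc a + 1) * normc (y - x)).
    by field; lra.
  rewrite Normc.normcM; apply: ler_pM; rewrite ?normc_ge0 ?lerDl //; exact: dlP.
have hmax' x : normc (x - z0) < r -> re (a * h x) <= re (a * h z0).
  move=> xr; rewrite aE /=; apply: le_trans (ler_norm _) _.
  apply: le_trans (re_le_normc _) _.
  by rewrite Normc.normcM na expr2 ler_wpM2l ?normc_ge0 ?hmax.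
have := strong_max hh' hmax' zr.
rewrite aE /= => E; apply/eqP; rewrite eq_le hmax //=.
have [n0|n0] := eqVneq (normc (h z0)) 0; first by rewrite n0 normc_ge0.
have n0' : 0 < normc (h z0) by rewrite lt_def n0 normc_ge0.
rewrite -(ler_pM2l n0') -expr2 -E -{1}na -Normc.normcM.
exact: le_trans (ler_norm _) (re_le_normc _).
Qed.

End MaximumPrinciple.

(** * The identity theorem on a disc *)

Section Identity.
Variable R : realType.
Local Notation C := R[i].
Implicit Types (h : C -> C) (z w d : C).

Lemma dist_normc z w : `|normc z - normc w| <= normc (z - w).
Proof.
rewrite ler_norml; apply/andP; split.
  by have := le_normcD z (w - z); rewrite subrKC (normcB z w); lra.
by have := le_normcD w (z - w); rewrite subrKC; lra.
Qed.

Lemma normc_gt0 z : (0 < normc z) = (z != 0).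
Proof.
rewrite lt_def normc_ge0 andbT; congr (~~ _).
apply/eqP/eqP => [/Normc.eq0_normc//|->]; by rewrite normc_real normr0.
Qed.

Lemma normc0 : normc (0 : C) = 0. Proof. by rewrite normc_real normr0. Qed.

Lemma pair_continuous (phi : C -> R) z :
  (forall e : R, 0 < e -> exists2 dl : R, 0 < dl &
    forall w, normc (w - z) < dl -> `|phi w - phi z| <= e) ->
  {for (re z, im z), continuous (fun p : R * R => phi (p.1 +i* p.2)%C)}.
Proof.
move=> cphi; apply/cvgrPdist_le => e e0; have [dl dl0 dlP] := cphi e e0.
have dl2 : 0 < dl / 2 by rewrite divr_gt0.
exists (ball (re z) (dl / 2), ball (im z) (dl / 2)).
  by split; apply: nbhsx_ballx.
move=> [x y] [/= b1 b2]; rewrite distrC.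
have -> : (re z +i* im z)%C = z by apply: complexP.
apply: dlP; have -> : (x +i* y)%C - z = ((x - re z) +i* (y - im z))%C.
  by apply: complexP; rewrite ?reD ?imD ?reN ?imN.
apply: le_lt_trans (normc_le_norm1 _ _) _.
rewrite [dl]splitr; apply: ltrD; by rewrite distrC.
Qed.

(** Compactness is taken in [R * R], where the disc is a closed part of a square. *)
Lemma closed_disc_max (phi : C -> R) (rho : R) : 0 <= rho ->
  (forall z, normc z <= rho -> forall e : R, 0 < e -> exists2 dl : R, 0 < dl &
    forall w, normc (w - z) < dl -> `|phi w - phi z| <= e) ->
  exists2 z, normc z <= rho & forall w, normc w <= rho -> phi w <= phi z.
Proof.
move=> rho0 cphi.
pose sq : set (R * R) := `[- rho, rho]%classic `*` `[- rho, rho]%classic.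
pose D : set (R * R) := [set p | normc (p.1 +i* p.2)%C <= rho].
have Dc : closed D.
  apply: (@closed_comp _ _ (fun p : R * R => normc (p.1 +i* p.2)%C) [set x | x <= rho]).
    move=> [x y] _; apply: (@pair_continuous (@Normc.normc R) (x +i* y)%C) => e e0.
    by exists e => // w wz; apply: le_trans (dist_normc _ _) (ltW wz).
  exact: closed_le.
have cpt : compact (sq `&` D).
  apply: compact_closedI => //; apply: compact_setX; exact: segment_compact.
have inD (w : C) : normc w <= rho -> (sq `&` D) (re w, im w).
  move=> wr; split; last by rewrite /D /=; case: w wr.
  by split; rewrite /= in_itv /= -ler_norml;
    [apply: le_trans (re_le_normc _) wr | apply: le_trans (im_le_normc _) wr].
have [||p pD pmax] := @compact_EVT_max _ R
    (fun p : R * R => phi (p.1 +i* p.2)%C) (sq `&` D) _ cpt.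
- by exists (re (0 : C), im (0 : C)); apply: inD; rewrite normc0.
- apply: continuous_in_subspaceT => -[x y]; rewrite inE => -[_ Dxy].
  exact: (pair_continuous (cphi _ Dxy)).
exists (p.1 +i* p.2)%C; first by move: pD; rewrite inE => -[].
move=> w /inD wD; have := pmax _ (mem_set wD).
by rewrite /=; case: w wD.
Qed.

Lemma holo_cvg (r : R) h z : holo 0 r h -> normc z < r -> forall e : R, 0 < e ->
  exists2 dl : R, 0 < dl & forall w, normc (w - z) < dl -> `|normc (h w) - normc (h z)| <= e.
Proof.
move=> hh zr e e0; have [|d hd] := hh z; first by rewrite subr0.
have [dl dl0 dlP] := cdiff_cvg hd e0; exists dl => // w wz.
exact: le_trans (dist_normc _ _) (dlP w wz).
Qed.

Lemma max_modulus h (r rho M : R) : 0 <= rho -> rho < r -> holo 0 r h ->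
  (forall z, normc z = rho -> normc (h z) <= M) ->
  forall z, normc z <= rho -> normc (h z) <= M.
Proof.
move=> rho0 rr hh hM z0 z0r.
have [z1 z1r z1max] : exists2 z, normc z <= rho &
    forall w, normc w <= rho -> normc (h w) <= normc (h z).
  apply: closed_disc_max => // z zr; apply: holo_cvg hh _; exact: le_lt_trans zr rr.
apply: le_trans (z1max _ z0r) _; rewrite leNgt; apply/negP => Mm.
set m := normc (h z1) in z1max Mm.
have [E|z1lt] := eqVneq (normc z1) rho.
  by have := hM _ E; rewrite leNgt Mm.
pose sg := rho - normc z1.
have sg0 : 0 < sg by rewrite subr_gt0 lt_neqAle z1lt.
have same z : normc (z - z1) < sg -> normc (h z) = m.
  apply: strong_max_modulus => [x xz|x xz].
    apply: hh; rewrite subr0; apply: le_lt_trans rr.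
    by have := le_normcD z1 (x - z1); rewrite subrKC; move: xz; rewrite /sg; lra.
  apply: z1max.
  by have := le_normcD z1 (x - z1); rewrite subrKC; move: xz; rewrite /sg; lra.
(* The contact point is [rho * u], with [u] the direction of [z1], or 1 if [z1] is 0. *)
have [u u1 uz] : exists2 u : C, normc u = 1 & z1 = ((normc z1)%:C)%C * u.
  have [->|z10] := eqVneq z1 0.
    by exists 1; [rewrite normc_real normr1 | rewrite normc0 mul0r].
  exists (((normc z1)%:C)%C^-1 * z1).
    rewrite Normc.normcM Normc.normcV normc_real ger0_norm ?normc_ge0 //.
    by rewrite mulVf // gt_eqF // normc_gt0.
  rewrite mulrA mulfV ?mul1r //; apply: contra z10 => /eqP[] /Normc.eq0_normc ->.
  by [].
have wr : normc ((rho%:C)%C * u) = rho.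
  by rewrite Normc.normcM u1 mulr1 normc_real ger0_norm.
have e0 : 0 < (m - M) / 2 by rewrite divr_gt0 // subr_gt0.
have [|dl dl0 dlP] := holo_cvg hh (z := (rho%:C)%C * u) _ e0; first by rewrite wr.
pose de := Num.min (dl / 2) sg.
have de0 : 0 < de by rewrite lt_min sg0 divr_gt0.
have desg : de <= sg by rewrite ge_min lexx orbT.
have dedl : de < dl by rewrite gt_min; apply/orP; left; lra.
have scal (s t : R) : normc ((s%:C)%C * u - (t%:C)%C * u) = `|s - t|.
  by rewrite -mulrBl -rmorphB Normc.normcM u1 mulr1 normc_real.
have := hM _ wr; have := dlP (((rho - de)%:C)%C * u).
rewrite scal addrAC subrr add0r normrN gtr0_norm // => /(_ dedl).
rewrite same; first by rewrite ler_norml => /andP[? ?]; lra.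
rewrite {1}uz scal.
have -> : rho - de - normc z1 = sg - de by rewrite /sg; ring.
by rewrite ger0_norm; lra.
Qed.

Lemma cdiff_div_id h z d : z != 0 -> cdiff h z d ->
  cdiff (fun w => h w / w) z ((d - h z / z) / z).
Proof.
move=> z0 hd e e0.
have nz : 0 < normc z by rewrite normc_gt0.
(* For [normc w >= normc z / 2], the first summand of [K] bounds the modulus of [D / (z ^+ 2 * w)];
   the [+ 1] keeps [K] positive. *)
pose D := d * z - h z; pose K := 2 * normc D / normc z ^+ 3 + 1.
have K0 : 0 < K.
  by rewrite /K ltr_wpDl // divr_ge0 ?mulr_ge0 ?normc_ge0 // exprn_ge0 // normc_ge0.
have e1 : 0 < e / 4 * normc z by rewrite !mulr_gt0 // invr_gt0.
have [dl dl0 dlP] := hd _ e1.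
exists (Num.min dl (Num.min (normc z / 2) (e / (2 * K)))).
  by rewrite !lt_min dl0 !divr_gt0 // mulr_gt0.
move=> w; rewrite !lt_min => /and3P[w1 w2 w3].
have nw : normc z / 2 <= normc w.
  by have := le_normcD w (z - w); rewrite subrKC (normcB z w); lra.
have nw0 : 0 < normc w by lra.
have w0 : w != 0 by rewrite -normc_gt0.
have := dlP _ w1; set E := h w - _ - _ => HE.
have -> : h w / w - h z / z - (d - h z / z) / z * (w - z) =
   E / w - (w - z) * ((w - z) * (D / (z ^+ 2 * w))).
  by rewrite /E /D; field; rewrite w0 z0.
apply: le_trans (le_normcD _ _) _; rewrite normcN !Normc.normcM Normc.normcV.
set a := normc (w - z) in HE w1 w2 w3 *.
have a0 : 0 <= a by exact: normc_ge0.
have iw : (normc w)^-1 <= 2 / normc z.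
  by rewrite -[2]invrK -invfM lef_pV2 ?posrE ?mulr_gt0 ?invr_gt0 // mulrC.
have -> : e * a = e / 4 * normc z * a * (2 / normc z) + a * (e / (2 * K) * K).
  by field; rewrite !gt_eqF.
apply: lerD; first by apply: ler_pM; rewrite ?normc_ge0 // invr_ge0 normc_ge0.
rewrite ler_wpM2l //; apply: ler_pM; rewrite ?normc_ge0 ?(ltW w3) //.
  by rewrite mulr_ge0 ?normc_ge0 // invr_ge0 normc_ge0.
rewrite Normc.normcV !Normc.normcM invfM.
apply: (@le_trans _ _ (normc D * ((normc z * normc z)^-1 * (2 / normc z)))).
  rewrite ler_wpM2l ?normc_ge0 // ler_wpM2l // invr_ge0 mulr_ge0 ?normc_ge0 //.
rewrite /K (_ : _ * _ = 2 * normc D / normc z ^+ 3) ?lerDl //.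
by field; rewrite gt_eqF.
Qed.

(** Induction through [h z / z], which still vanishes near 0 and is bounded by [M / rho] on the
    circle; each division gains a factor [normc z0 / rho]. *)
Lemma vanish_decay h (r R0 rho M : R) z0 n : 0 < r -> 0 < rho -> rho < R0 -> 0 < normc z0 <= rho ->
  holo 0 R0 h -> (forall z, normc z < r -> h z = 0) ->
  (forall z, normc z = rho -> normc (h z) <= M) ->
  normc (h z0) <= M * (normc z0 / rho) ^+ n.
Proof.
move=> r0 rho0 rhoR /andP[q0 qr]; elim: n h M => [|n ih] h M hh hv hM.
  by rewrite expr0 mulr1; exact: (max_modulus (ltW rho0) rhoR hh hM).
have := ih (fun z => h z / z) (M / rho).
rewrite Normc.normcM Normc.normcV ler_pdivrMr // => H.
apply: le_trans (H _ _ _) _.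
- move=> z zR; have [zr|rz] := ltP (normc z) r.
    (* On the small disc the quotient is [0 / w], which is 0 at the centre too. *)
    exists 0 => e e0; exists (r - normc z); first by rewrite subr_gt0.
    move=> w wz; rewrite !hv ?mul0r ?subrr ?normc0 ?mulr_ge0 ?normc_ge0 ?(ltW e0) //.
    by have := le_normcD z (w - z); rewrite subrKC; lra.
  have [d hd] := hh z zR; exists ((d - h z / z) / z); apply: cdiff_div_id => //.
  by rewrite -normc_gt0 (lt_le_trans r0).
- by move=> z zr; rewrite hv ?mul0r.
- by move=> z zr; rewrite Normc.normcM Normc.normcV zr ler_pM2r ?invr_gt0 ?hM.
rewrite exprSr le_eqVlt; apply/orP; left; apply/eqP.
by set x := (_ / _) ^+ n; field; rewrite gt_eqF.
Qed.

(** By [vanish_decay], [h z - k] is at most a constant times [(normc z / rho) ^+ n] for every [n],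
    with [rho] strictly between [normc z] and [R0]. *)
Lemma disc_identity h (r R0 : R) k : 0 < r -> holo 0 R0 h ->
  (forall z, normc z < r -> h z = k) -> forall z, normc z < R0 -> h z = k.
Proof.
move=> r0 hh hk z zR; apply/eqP; rewrite -subr_eq0; apply/negPn/negP => nz.
pose g z := h z - k.
have gg : holo 0 R0 g.
  move=> w wR; have [d hd] := hh w wR; exists d => e e0.
  have [dl dl0 dlP] := hd e e0; exists dl => // y yw.
  by rewrite /g opprB addrA subrK; exact: dlP.
have gk w : normc w < r -> g w = 0 by move=> wr; rewrite /g hk ?subrr.
have [zr|rz] := ltP (normc z) r; first by case/negP: nz; rewrite hk ?subrr.
have q0 : 0 < normc z by exact: lt_le_trans rz.
pose rho := (normc z + R0) / 2.
have qrho : normc z < rho by rewrite /rho; lra.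
have rhoR : rho < R0 by rewrite /rho; lra.
have rho0 : 0 < rho by lra.
clearbody rho.
have [z1 z1r z1max] : exists2 z, normc z <= rho &
    forall w, normc w <= rho -> normc (g w) <= normc (g z).
  apply: closed_disc_max => [|w wr]; first exact: ltW.
  apply: holo_cvg gg _; exact: le_lt_trans wr rhoR.
set M := normc (g z1) in z1max.
have decay n : normc (g z) <= M * (normc z / rho) ^+ n.
  apply: (@vanish_decay g r R0) => //; first by rewrite q0 ltW.
  by move=> w wr; apply: z1max; rewrite wr.
have x1 : `|normc z / rho| < 1.
  by rewrite ger0_norm ?divr_ge0 ?(ltW q0) ?(ltW rho0) // ltr_pdivrMr // mul1r.
have M0 : 0 < M + 1 by have := normc_ge0 (g z1); rewrite /M; lra.
have gz0 : 0 < normc (g z) by rewrite normc_gt0.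
have e0 : 0 < normc (g z) / (M + 1) by rewrite divr_gt0.
have /cvgrPdist_lt /(_ _ e0) [n _ /(_ n (leqnn n))] := cvg_expr x1.
rewrite /= sub0r normrN => H; have := decay n; rewrite leNgt => /negP; apply.
have {}H := le_lt_trans (ler_norm _) H.
apply: le_lt_trans (_ : _ <= (M + 1) * (normc z / rho) ^+ n) _.
  by rewrite ler_wpM2r ?lerDl // exprn_ge0 // divr_ge0 ?(ltW q0) ?(ltW rho0).
by rewrite mulrC -ltr_pdivlMr.
Qed.

End Identity.

(** * Propagation along polygonal chains *)

(** From a point of [S] just below [sup S], the step at [sup S] leads beyond it unless it reaches
    1. *)
Lemma interval_induction (R : realType) (T : R -> Prop) : T 0 ->
  (forall t : R, 0 <= t <= 1 -> exists2 e : R, 0 < e &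
    forall t' t'' : R, 0 <= t' <= 1 -> 0 <= t'' <= 1 ->
      `|t' - t| < e -> `|t'' - t'| < e -> T t' -> T t'') ->
  T 1.
Proof.
move=> T0 step; pose S : set R := [set t | 0 <= t <= 1 /\ T t].
have S0 : S 0 by split=> //; rewrite lexx ler01.
have Sub : has_ubound S by exists 1 => t [/andP[]].
have Ss : has_sup S by split; [exists 0|].
have s01 : 0 <= sup S <= 1.
  by rewrite ub_le_sup //=; apply: ge_sup; [exists 0|move=> t [/andP[]]].
have [e e0 eP] := step _ s01.
have [t [t01 Tt] ts] := sup_adherent (divr_gt0 e0 (@ltr0n R 2)) Ss.
have tsup : t <= sup S by apply: ub_le_sup.
pose t2 := Num.min 1 (sup S + e / 4).
have [t21 t2s] : t2 <= 1 /\ t2 <= sup S + e / 4 by rewrite !ge_min !lexx orbT.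
have st2 : sup S <= t2 by rewrite le_min; case/andP: s01 => _ ->; rewrite /=; lra.
have t201 : 0 <= t2 <= 1 by rewrite t21 andbT; case/andP: t01 => h _; lra.
have Tt2 : T t2.
  by apply: eP t01 t201 _ _ Tt; rewrite ltr_norml; apply/andP; split; lra.
have t2sup : t2 <= sup S by apply: ub_le_sup.
have : t2 = 1 \/ t2 = sup S + e / 4.
  by rewrite /t2 /Num.min; case: ifP; [left|right].
by case=> E; [rewrite -E | lra].
Qed.

Section Propagation.
Variables (R : realType) (X : lmodType R[i]).
Local Notation C := R[i].

Lemma d_open_box (d k : nat) (A : set X) (a : X) (v : 'I_k -> X) :
  d_open d A -> (1 <= k <= d)%N -> lin_indep v -> A a ->
  exists2 e : R, 0 < e & forall z : 'I_k -> C, (forall j, normc (z j) < e) ->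
    A (a + \sum_(j < k) z j *: v j).
Proof.
move=> Ao kd vi Aa; have := Ao k kd a v vi; rewrite openE => /(_ 0).
have A0 : A (a + \sum_(j < k) (0 : 'rV[C^o]_k) ord0 j *: v j).
  by rewrite big1 ?addr0 // => j _; rewrite mxE scale0r.
move=> /(_ A0) /nbhs_ballP [e /= /gt0_complex[e0 eE] eP].
exists (re e) => // z ze.
have := eP (\row_j (z j : C^o)); rewrite /ball /=.
have -> : \sum_(j < k) (\row_j z j) ord0 j *: v j = \sum_(j < k) z j *: v j.
  by apply: eq_bigr => j _; rewrite mxE.
apply; split; first by rewrite eE ltcR.
move=> i j; rewrite !mxE /ball /= sub0r normrN normE eE ltcR; exact: ze.
Qed.

Lemma d_open_line (d : nat) (A : set X) (a v : X) : (1 <= d)%N -> d_open d A -> A a ->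
  exists2 e : R, 0 < e & forall l : C, normc l < e -> A (a + l *: v).
Proof.
move=> d1 Ao Aa; have [->|v0] := eqVneq v 0.
  by exists 1 => // l _; rewrite scaler0 addr0.
have [|c ec j|e e0 eP] := @d_open_box d 1 A a (fun=> v) Ao _ _ Aa; first by [].
  move: ec; rewrite big_ord1 => /eqP; rewrite scaler_eq0 (negPf v0) orbF.
  by rewrite (ord1 j) => /eqP.
by exists e => // l le; have := eP (fun=> l) (fun=> le); rewrite big_ord1.
Qed.

Definition indep2 (v w : X) : Prop := forall s t : C, s *: v + t *: w = 0 -> s = 0 /\ t = 0.

Lemma d_open_plane (A : set X) (a v w : X) : d_open 2 A -> indep2 v w -> A a ->
  exists2 e : R, 0 < e & forall s t : C, normc s < e -> normc t < e ->
    A (a + (s *: v + t *: w)).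
Proof.
move=> Ao vw Aa; pose V (j : 'I_2) := if j == ord0 then v else w.
have sumV (z : 'I_2 -> C) :
    \sum_(j < 2) z j *: V j = z ord0 *: v + z (lift ord0 ord0) *: w.
  by rewrite big_ord_recl big_ord1.
have [//|c|e e0 eP] := @d_open_box 2 2 A a V Ao _ _ Aa.
  rewrite sumV => /vw[c0 c1] j; have [->//|] := eqVneq j ord0.
  by case: (unliftP ord0 j) => [i -> _|-> /eqP//]; rewrite (ord1 i).
exists e => // s t se te.
have := eP (fun j => if j == ord0 then s else t); rewrite sumV; apply.
by move=> j; case: ifP.
Qed.

Lemma indep2_of_not_colinear (v w : X) : v != 0 -> (forall c : C, w <> c *: v) ->
  indep2 v w.
Proof.
move=> v0 nc s t E; have [t0|t0] := eqVneq t 0.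
  move: E; rewrite t0 scale0r addr0 => /eqP.
  by rewrite scaler_eq0 (negPf v0) orbF => /eqP.
case: (nc (- (t^-1 * s))); move/eqP: E; rewrite addrC addr_eq0 => /eqP E.
by rewrite scaleNr -scalerA -scalerN -E scalerA mulVf // scale1r.
Qed.

(** A second direction is wanted even if [u] is a multiple of [v], since constancy is propagated
    within planes. *)
Lemma exists_plane (v u : X) : dim_ge2 X -> v != 0 ->
  exists w, indep2 v w /\ exists s t : C, u = s *: v + t *: w.
Proof.
move=> [u0 [w0 uw]] v0.
have [[c uE]|nc] := pselect (exists c : C, u = c *: v); last first.
  exists u; split; last by exists 0, 1; rewrite scale0r scale1r add0r.
  by apply: indep2_of_not_colinear => // c uE; apply: nc; exists c.
have [w vw] : exists w, indep2 v w.
  have [[a uE0]|nc] := pselect (exists c : C, u0 = c *: v); last first.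
    by exists u0; apply: indep2_of_not_colinear => // c' E; apply: nc; exists c'.
  have [[b wE0]|nc] := pselect (exists c : C, w0 = c *: v); last first.
    by exists w0; apply: indep2_of_not_colinear => // c' E; apply: nc; exists c'.
  (* If [u0 = a v] and [w0 = b v], the relation [b u0 - a w0 = 0] forces [a = 0], so [u0 = 0],
     against independence. *)
  have [|b0 /eqP] := uw b (- a).
    by rewrite uE0 wE0 scaleNr !scalerA mulrC subrr.
  rewrite oppr_eq0 => /eqP a0; have [|/eqP] := uw 1 0.
    by rewrite uE0 a0 !scale0r scaler0 addr0.
  by rewrite oner_eq0.
by exists w; split=> //; exists c, 0; rewrite scale0r addr0.
Qed.

Variables (Om : set X) (g : X -> C) (k : C).

Hypothesis g_holo : forall a v, Om a ->
  exists d, cdiff (fun l : C => g (a + l *: v)) 0 d.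

(** Differentiability at parameter 0 from every base point in [Om] gives it at all parameters, by
    moving the base point. *)
Lemma holo_line (a v : X) (r : R) :
  (forall l, normc l < r -> Om (a + l *: v)) -> holo 0 r (fun l => g (a + l *: v)).
Proof.
move=> Oav z; rewrite subr0 => zr; have [d hd] := g_holo v (Oav _ zr).
exists d => e e0; have [dl dl0 dlP] := hd e e0; exists dl => // w wz.
have := dlP (w - z); rewrite subr0 scale0r addr0 => /(_ wz).
by have -> : a + z *: v + (w - z) *: v = a + w *: v by rewrite -addrA -scalerDl subrKC.
Qed.

(** The radius depends on the direction, as constancy is first known line by line only. *)
Definition germ_const (v w a : X) : Prop := forall s t : C, exists2 r : R, 0 < r &
  forall l : C, normc l < r -> g (a + l *: (s *: v + t *: w)) = k.

(* Every point of the polydisc lies on a disc through its center. *)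
Lemma germ_const_polydisc (v w a : X) (e : R) :
  (forall s t, normc s < e -> normc t < e -> Om (a + (s *: v + t *: w))) ->
  germ_const v w a ->
  forall s t, normc s < e -> normc t < e -> g (a + (s *: v + t *: w)) = k.
Proof.
move=> Oe ga s t se te.
(* Since [m <= m' < e], the disc of parameters of radius [e / m' > 1] stays in the polydisc and
   contains 1; [m'] is positive even when [s = t = 0]. *)
pose m := Num.max (normc s) (normc t); pose m' := (m + e) / 2.
have me : m < e by rewrite gt_max se.
have m0 : 0 <= m by rewrite le_max normc_ge0.
have [sm tm] : normc s <= m /\ normc t <= m by rewrite !le_max !lexx orbT.
have m'0 : 0 < m' by rewrite /m'; lra.
have [mm' m'e] : m < m' /\ m' < e by rewrite /m'; lra.
clearbody m' m.
have small (l x : C) : normc l < e / m' -> normc x <= m -> normc (l * x) < e.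
  rewrite ltr_pdivlMr // => le xm; apply: le_lt_trans le.
  by rewrite Normc.normcM ler_wpM2l ?normc_ge0 //; lra.
have [r r0 rP] := ga s t.
have hol : holo 0 (e / m') (fun l => g (a + l *: (s *: v + t *: w))).
  by apply: holo_line => l le; rewrite scalerDr !scalerA; apply: Oe; exact: small.
have := disc_identity r0 hol rP (z := 1); rewrite scale1r; apply.
by rewrite normc_real normr1 ltr_pdivlMr // mul1r.
Qed.

(** [g] is constant on the whole polydisc around [a], which contains a small disc around the new
    point on each line of the plane. *)
Lemma germ_const_move (v w a : X) (e : R) (s0 : C) :
  (forall s t, normc s < e -> normc t < e -> Om (a + (s *: v + t *: w))) ->
  germ_const v w a -> normc s0 < e -> germ_const v w (a + s0 *: v).
Proof.
move=> Oe ga s0e s t.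
have n0 : 0 < normc s + normc t + 1.
  by have := normc_ge0 s; have := normc_ge0 t; lra.
have e0 : 0 < e by apply: le_lt_trans s0e; exact: normc_ge0.
exists ((e - normc s0) / (normc s + normc t + 1)); first by rewrite divr_gt0 ?subr_gt0.
move=> l; rewrite ltr_pdivlMr // => le.
have [ls lt0] : normc (l * s) <= normc l * (normc s + normc t + 1) /\
    normc (l * t) <= normc l * (normc s + normc t + 1).
  rewrite !Normc.normcM; split; apply: ler_wpM2l; rewrite ?normc_ge0 //;
    have := normc_ge0 s; have := normc_ge0 t; lra.
have -> : a + s0 *: v + l *: (s *: v + t *: w) =
    a + ((s0 + l * s) *: v + (l * t) *: w).
  by rewrite scalerDr !scalerA scalerDl !addrA.
apply: (germ_const_polydisc Oe ga).
  by have := le_normcD s0 (l * s); lra.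
by have := normc_ge0 s0; lra.
Qed.

Lemma germ_const_segment (v w a : X) : d_open 2 Om -> indep2 v w ->
  (forall t : R, 0 <= t <= 1 -> Om (a + (t%:C)%C *: v)) ->
  germ_const v w a -> germ_const v w (a + v).
Proof.
move=> Oo vw Oseg ga; rewrite -[X in _ + X]scale1r.
apply: (@interval_induction _ (fun t => germ_const v w (a + (t%:C)%C *: v))).
  by rewrite scale0r addr0.
move=> t t01; have [e e0 eP] := d_open_plane Oo vw (Oseg t t01).
(* Half the radius leaves a polydisc of radius [e / 2] in [Om] around every centre [t'] within
   [e / 2] of [t]. *)
exists (e / 2) => [|t' t'' t'01 t''01 tt' t't'' gt']; first by rewrite divr_gt0.
have -> : a + (t''%:C)%C *: v = a + (t'%:C)%C *: v + ((t'' - t')%:C)%C *: v.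
  by rewrite -addrA -scalerDl -rmorphD subrKC.
apply: (@germ_const_move _ _ _ (e / 2)) => //; last by rewrite normc_real.
move=> s u se ue.
have -> : a + (t'%:C)%C *: v + (s *: v + u *: w) =
    a + (t%:C)%C *: v + (((t' - t)%:C%C + s) *: v + u *: w).
  rewrite -!(addrA a); congr (_ + _); rewrite !addrA -!scalerDl.
  by congr (_ *: _ + _); rewrite rmorphB; ring.
apply: eP; last by lra.
have := le_normcD ((t' - t)%:C)%C s; rewrite normc_real; lra.
Qed.

Definition line_const (a : X) : Prop := forall v, exists2 r : R, 0 < r &
  forall l : C, normc l < r -> g (a + l *: v) = k.

(** Each direction [u] at [b] is treated in a plane containing both [b - a] and [u], along which
    constancy is carried from [a] to [b]. *)
Lemma line_const_segment (a b : X) : dim_ge2 X -> d_open 2 Om ->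
  (forall t : R, 0 <= t <= 1 -> Om ((1 - (t%:C)%C) *: a + (t%:C)%C *: b)) ->
  line_const a -> line_const b.
Proof.
move=> X2 Oo Oseg la; have [<-//|ab] := eqVneq a b.
move=> u; have v0 : b - a != 0 by rewrite subr_eq0 eq_sym.
have [w [vw [s [t ->]]]] := exists_plane u X2 v0.
suff : germ_const (b - a) w (a + (b - a)) by rewrite subrKC; exact.
have ga : germ_const (b - a) w a by move=> s' t'; exact: (la (s' *: (b - a) + t' *: w)).
have Os r : 0 <= r <= 1 -> Om (a + (r%:C)%C *: (b - a)).
  by move=> /Oseg; rewrite scalerBl scale1r scalerBr addrA addrAC.
exact: (germ_const_segment Oo vw Os ga).
Qed.

Lemma line_const_polygonal (a : X) : dim_ge2 X -> d_open 2 Om ->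
  polygonally_connected Om -> Om a -> line_const a -> forall b, Om b -> g b = k.
Proof.
move=> X2 Oo Op Oa la b Ob; have [n [z [z0 [zn zP]]]] := Op a b Oa Ob.
have lz i : (i <= n)%N -> line_const (z i).
  elim: i => [_|i ih ilt]; first by rewrite z0.
  exact: line_const_segment X2 Oo (zP i ilt) (ih (ltnW ilt)).
have [r r0 rP] := lz n (leqnn n) 0; have := rP 0.
by rewrite normc0 scaler0 addr0 zn; exact.
Qed.

End Propagation.

(** * Functionals dominated by a continuous seminorm *)

Section Functional.
Variables (R : realType) (Y : tvsType R[i]) (p : Y -> R).
Local Notation C := R[i].
Hypothesis ps : continuous_seminorm p.

Lemma seminorm0 : p 0 = 0.
Proof. by case: ps => _ _ ph _; have := ph 0 0; rewrite scale0r normc0 mul0r. Qed.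

Lemma nbhs_seminorm_ball (y : Y) (e : R) : 0 < e -> nbhs y [set z | p (z - y) < e].
Proof.
move=> e0; have [p0 _ _ pc] := ps.
have U0 : nbhs 0 [set z | p z < e].
  have /cvgrPdist_lt /(_ e e0) := pc 0; apply: filterS => z.
  by rewrite /= seminorm0 sub0r normrN ger0_norm.
by apply: filterS (nbhsT y U0) => _ [z /= pz <-]; rewrite addrAC subrr add0r.
Qed.

Variable phi : {linear Y -> C^o}.
Hypothesis phip : forall y, normc (phi y) <= p y.

Lemma dominated_continuous : continuous phi.
Proof.
move=> y; apply/cvgrPdist_lt => e /gt0_complex[e0 eE].
apply: filterS (nbhs_seminorm_ball y e0) => z /= pz.
by rewrite eE normE ltcR normcB -linearB; exact: le_lt_trans (phip _) pz.
Qed.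

(** The closure stays in the hyperplane [phi = k], whereas a small move along [y1] from an interior
    point would remain in the closure and change [phi]. *)
Lemma hyperplane_closure_interior0 (A : set Y) (k : C) (y1 : Y) :
  phi y1 != 0 -> (forall y, A y -> phi y = k) -> interior (closure A) = set0.
Proof.
move=> y10 Ak.
have clk y : closure A y -> phi y = k.
  move=> cy; apply/eqP; rewrite -subr_eq0 -[_ == _]negbK -normc_gt0; apply/negP => n0.
  have [z [Az /= pz]] := cy _ (nbhs_seminorm_ball y n0).
  by have := le_lt_trans (phip _) pz; rewrite linearB (Ak _ Az) normcB ltxx.
rewrite -subset0 => y iy.
have := @nbhsB _ _ (closure A) y (- y) iy; rewrite addNr => V0.
have := @scale_continuous _ Y (0, y1) (+%R (- y) @` closure A).
rewrite /= scale0r => /(_ V0) [[B D] /= [B0 D1] BD].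
have /nbhs_ballP [e /= /gt0_complex[e0 eE] eB] := B0.
have te : ball (0 : C^o) e ((re e / 2)%:C)%C.
  rewrite /ball /= sub0r normrN normE eE ltcR normc_real.
  by rewrite ger0_norm ?divr_ge0 ?(ltW e0) // ltr_pdivrMr // ltr_pMr // ltr1n.
have [z cz zE] := BD ((re e / 2)%:C%C, y1) (conj (eB _ te) (nbhs_singleton D1)).
have : phi (- y + z) = 0 by rewrite linearD linearN (clk _ cz) (clk _ (interior_subset iy)) addNr.
rewrite zE /= linearZ /= => /eqP; rewrite mulf_eq0 (negPf y10) orbF => /eqP[] /eqP.
by rewrite mulf_eq0 invr_eq0 (gt_eqF e0) /= pnatr_eq0.
Qed.

End Functional.

(** * Constancy of the norming functional along [f] *)

Section LocalMax.
Variables (R : realType) (X : lmodType R[i]) (Y : tvsType R[i]) (Om : set X)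
  (f : X -> Y) (p : Y -> R) (c : X) (phi : {linear Y -> R[i]^o}).
Hypotheses (X2 : dim_ge2 X) (Op : polygonally_connected Om) (Oo : d_open 2 Om)
  (fh : gateaux_holomorphic Om f) (ps : continuous_seminorm p) (Oc : Om c)
  (cmax : tau1_local_max Om (p \o f) c)
  (phip : forall y, normc (phi y) <= p y) (phic : phi (f c) = ((p (f c))%:C)%C).

(** Near [c] on each line, [|phi o f| <= p o f <= p (f c) = phi (f c)]. So the real part is maximal
    at [c], hence constant, and the modulus bound then kills the imaginary part. *)
Lemma local_max_functional_const x : Om x -> phi (f x) = ((p (f c))%:C)%C.
Proof.
pose g (x : X) : R[i] := phi (f x).
have gh a v : Om a -> exists d, cdiff (fun l : R[i] => g (a + l *: v)) 0 d.
  move=> Oa; have [r r0 [_ gr]] := fh Oa v (dominated_continuous ps phip).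
  by apply: derivable_cdiff; apply: gr; rewrite normc0.
move: x; apply: (line_const_polygonal gh X2 Oo Op Oc) => v.
have [U [Uo [Uc Um]]] := cmax.
have [r1 r10 r1P] := d_open_line v (isT : 1 <= 1)%N Uo Uc.
have [r2 r20 r2P] := d_open_line v (isT : 1 <= 2)%N Oo Oc.
(* [r1] keeps the disc in the neighbourhood where [c] is maximal, [r2] keeps it in [Om]. *)
exists (Num.min r1 r2); first by rewrite lt_min r10.
have le0 l : normc l < Num.min r1 r2 -> normc (g (c + l *: v)) <= p (f c).
  rewrite lt_min => /andP[/r1P l1 /r2P l2].
  exact: le_trans (phip _) (Um _ l1 l2).
have hol : holo 0 (Num.min r1 r2) (fun l => g (c + l *: v)).
  by apply: (holo_line gh) => l; rewrite lt_min => /andP[_ /r2P].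
have re0 : re (g (c + 0 *: v)) = p (f c) by rewrite scale0r addr0 /g phic.
move=> l lr; apply: normc_le_re; first exact: le0.
rewrite -re0; apply: (strong_max hol); last by rewrite subr0.
move=> z; rewrite subr0 => /le0 zr; rewrite re0.
exact: le_trans (ler_norm _) (le_trans (re_le_normc _) zr).
Qed.

End LocalMax.

Unset Implicit Arguments.

Theorem mainTheorem6 (R : realType) (X : lmodType R[i]) (Y : tvsType R[i])
  (Om : set X) (f : X -> Y) (p : Y -> R) (c : X) :
  dim_ge2 X ->
  (exists y : Y, y != 0) ->
  hausdorff_space Y ->
  sequentially_complete Y ->
  polygonally_connected Om ->
  d_open 2 Om ->
  gateaux_holomorphic Om f ->
  continuous_seminorm p ->
  (exists y : Y, p y != 0) ->
  Om c ->
  tau1_local_max Om (p \o f) c ->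
  [/\ (forall x, Om x -> p (f c) <= p (f x)),
      interior (closure (f @` Om)) = set0
    & (0 < p (f c) -> ~ (f @` Om) 0)].
Proof.
move=> X2 _ _ _ Op Oo fh ps [y0 py0] Oc cmax; have [p0 psub phom _] := ps.
have gmin x : Om x -> p (f c) <= p (f x).
  have [phi [phip phic]] := hahn_banach psub phom (f c).
  move=> /(local_max_functional_const X2 Op Oo fh ps Oc cmax phip phic) E.
  by apply: le_trans (phip _); rewrite E normc_real ger0_norm.
split=> //; last first.
  by move=> pc [x Ox fx0]; have := gmin x Ox; rewrite fx0 (seminorm0 ps) leNgt pc.
(* Norming [phi] at [y] must give both [phi y != 0] and [phi (f c) = p (f c)]. Hence [y] is [f c]
   when [p (f c)] is nonzero; otherwise [phi (f c) = 0] is automatic and [y0] serves. *)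
have [y [py pyc]] : exists y, p y != 0 /\ (p (f c) != 0 -> y = f c).
  have [z|nz] := eqVneq (p (f c)) 0; first by exists y0; rewrite py0.
  by exists (f c).
have [phi [phip phiy]] := hahn_banach psub phom y.
have phic : phi (f c) = ((p (f c))%:C)%C.
  have [z|nz] := eqVneq (p (f c)) 0; last by rewrite -(pyc nz).
  by rewrite z; apply: Normc.eq0_normc; apply/eqP; rewrite eq_le normc_ge0 -z phip.
apply: (hyperplane_closure_interior0 ps phip (y1 := y)) => [|_ [x Ox <-]].
  by rewrite phiy; apply: contra py => /eqP[->].
exact: (local_max_functional_const X2 Op Oo fh ps Oc cmax phip phic Ox).
Qed.
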